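(* Let $H$ be a finite-dimensional Hopf algebra over $\Bbbk$, $\Gamma$ a finite group, and $\Upsilon=(L_a,(g(a,b),f^{a,b}),\gamma)_{a,b\in\Gamma}$ a crossed datum as in the context, with associated tensor category $\operatorname{Comod}(H)(\Upsilon)$. If $\operatorname{Comod}(H)(\Upsilon)$ is braided with braiding $c$, then the following conditions hold: (1) $L_a\simeq H$ (as biGalois objects) for all $a\in\Gamma$; (2) $\Gamma$ is abelian; (3) $\Upsilon$ comes from a datum $(g,f^{a,b},\gamma)_{a,b\in\Gamma}$ (i.e. with all $L_a=H$) where - $g\in Z^2(\Gamma,G(H))$ is normalized, - $f^{a,b}:H^{g(a,b)}\to H$ is a bicomodule algebra isomorphism, with $f^{ab,c}f^{a,b}=f^{a,bc}f^{b,c}$ for all $a,b,c\in\Gamma$, - $\gamma\in Z^3(\Gamma,\Bbbk^\times)$ is normalized.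
   Context: $\Bbbk$ is algebraically closed of characteristic zero. $\operatorname{Comod}(H)$ is the tensor category of finite-dimensional left $H$-comodules, $G(H)$ is the group of group-likes, and for $g\in G(H)$, $\Bbbk_g$ is the one-dimensional comodule $1\mapsto g\otimes1$. A left $H$-Galois extension of $\Bbbk$ is a left $H$-comodule algebra $(A,\rho)$ with coinvariants $\Bbbk$ such that $A\otimes A\to H\otimes A$, $a\otimes b\mapsto(1\otimes a)\rho(b)$ is bijective; similarly on the right. An $(H,H)$-biGalois object is an $H$-bicomodule algebra that is a left and a right $H$-Galois extension of $\Bbbk$; isomorphisms of biGalois objects are bijective bicomodule algebra maps. $\Box_H$ is the cotensor product. For a biGalois object $L$ and $g\in G(H)$, $L\Box_H\Bbbk_g$ is one-dimensional, and $\phi(L,g)\in G(H)$ is defined by $L\Box_H\Bbbk_g\simeq\Bbbk_{\phi(L,g)}$. $L^g$ denotes $L$ with the same algebra structure and right coaction, and left coaction $a\mapsto g^{-1}a_{-1}g\otimes a_0$. A crossed datum is a collection $\Upsilon=(L_a,(g(a,b),f^{a,b}),\gamma)_{a,b\in\Gamma}$ where $L_a$ is an $(H,H)$-biGalois object, $g(a,b)\in G(H)$, $f^{a,b}:(L_a\Box_HL_b)^{g(a,b)}\to L_{ab}$ are bicomodule algebra isomorphisms, and $\gamma\in Z^3(\Gamma,\Bbbk^\times)$ is normalized, such that for all $a,b,c\in\Gamma$: $L_e=H$, $(g(e,a),f^{e,a})=(e,\operatorname{id}_{L_a})=(g(a,e),f^{a,e})$; $\phi(L_a,g(b,c))\,g(a,bc)=g(a,b)\,g(ab,c)$;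 and $f^{ab,c}(f^{a,b}\otimes\operatorname{id}_{L_c})=f^{a,bc}(\operatorname{id}_{L_a}\otimes f^{b,c})$. $\operatorname{Comod}(H)(\Upsilon)=\oplus_{a\in\Gamma}\operatorname{Comod}(H)$ as abelian category, with $[X,a]$ denoting $X$ in degree $a$, and tensor product $[X,a]\otimes[Y,b]=[X\otimes(L_a\Box_HY)\otimes\Bbbk_{g(a,b)},ab]$. Its associativity is $\gamma(a,b,c)$ times the canonical isomorphism built from the monoidal structure $(L_a\Box_HX)\otimes(L_a\Box_HY)\cong L_a\Box_H(X\otimes Y)$ (given by multiplication in $L_a$), from identifications $L_a\Box_H\Bbbk_{g(b,c)}\simeq\Bbbk_{\phi(L_a,g(b,c))}$, and from the isomorphisms $(L_a\Box_HL_b\Box_HZ)\otimes\Bbbk_{g(a,b)}\to\Bbbk_{g(a,b)}\otimes(L_{ab}\Box_HZ)$, $t\otimes1\mapsto1\otimes(f^{a,b}\otimes\operatorname{id}_Z)(t)$. $g\in Z^2(\Gamma,G(H))$ means $g(b,c)g(a,bc)=g(a,b)g(ab,c)$ for all $a,b,c$; normalized means $g(e,a)=e=g(a,e)$. *)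

(* Defs.v *)
From HB Require Import structures.
From mathcomp Require Import all_boot all_fingroup all_algebra falgebra.
From mathcomp Require Import boolp classical_sets.
Set Implicit Arguments.
Unset Strict Implicit.
Unset Printing Implicit Defensive.
Import GRing.Theory VectorInternalTheory.
Local Open Scope ring_scope.

(* Conventions.
   - All vector spaces are finite-dimensional (vectType), all algebras are
     finite-dimensional (falgType).  For biGalois objects over a
     finite-dimensional H this is automatic: the Galois map is an isomorphism of
     left A-modules from A (x) A onto H (x) A, and a free A-module with an
     infinite basis is not finitely generated.
   - Comodules are left comodules unless stated otherwise, and X (x) Y carries
     the codiagonal coaction x (x) y |-> x_{-1} y_{-1} (x) (x_0 (x) y_0).
   - Associativity constraints go from (X (x) Y) (x) Z to X (x) (Y (x) Z). *)

(* Tensor product of two finite-dimensional spaces, modelled by the matrices of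
   coordinates in the bases given by the vectType structures; tpure is the
   universal bilinear map and tlift the factorisation through it. *)
Definition tens (K : fieldType) (U V : vectType K) : Type :=
  'M[K]_(dim U, dim V).

HB.instance Definition _ (K : fieldType) (U V : vectType K) :=
  Vector.copy (tens U V) 'M[K]_(dim U, dim V).

Section TensorPure.
Variables (K : fieldType) (U V W : vectType K).

Definition tpure (u : U) (v : V) : tens U V := (v2r u)^T *m v2r v.

Definition tbasis (i : 'I_(dim U)) : U := r2v (delta_mx 0 i).

End TensorPure.
Infix "*t" := tpure (at level 40, left associativity) : ring_scope.

Definition tlift (K : fieldType) (U V W : vectType K) (f : U -> V -> W)
    (t : tens U V) : W :=
  \sum_i \sum_j (t : 'M[K]_(dim U, dim V)) i j *: f (tbasis i) (tbasis j).

Section Tensor.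
Variables (K : fieldType) (U V W : vectType K).
Implicit Types (u : U) (v : V).

Lemma tpureDl u u' v : (u + u') *t v = u *t v + u' *t v.
Proof. by rewrite /tpure !linearD /= mulmxDl. Qed.
Lemma tpureDr u v v' : u *t (v + v') = u *t v + u *t v'.
Proof. by rewrite /tpure linearD /= mulmxDr. Qed.
Lemma tpureZl a u v : (a *: u) *t v = a *: (u *t v).
Proof. by rewrite /tpure !linearZ /= -scalemxAl. Qed.
Lemma tpureZr a u v : u *t (a *: v) = a *: (u *t v).
Proof. by rewrite /tpure linearZ /= -scalemxAr. Qed.

Lemma tlift_is_linear (f : U -> V -> W) : linear (tlift f).
Proof.
move=> a s t; rewrite /tlift scaler_sumr -big_split; apply: eq_bigr => i _ /=.
rewrite scaler_sumr -big_split; apply: eq_bigr => j _ /=.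
by rewrite !mxE scalerDl scalerA.
Qed.
HB.instance Definition _ (f : U -> V -> W) :=
  GRing.isLinear.Build K (tens U V) W _ (tlift f) (tlift_is_linear f).

End Tensor.

Lemma tbasis_sum (K : fieldType) (U : vectType K) (u : U) :
  u = \sum_i v2r u 0 i *: tbasis i.
Proof.
apply: v2r_inj; rewrite linear_sum {1}[v2r u]row_sum_delta.
by apply: eq_bigr => i _; rewrite linearZ /= r2vK.
Qed.

Section TensorTheory.
Variables (K : fieldType) (U V : vectType K).

Definition bilin (W : vectType K) (f : U -> V -> W) :=
  (forall v, linear (f^~ v)) /\ (forall u, linear (f u)).

Lemma tliftE (W : vectType K) (f : U -> V -> W) u v :
  bilin f -> tlift f (u *t v) = f u v.
Proof.
move=> [fl fr]; rewrite {2}[u]tbasis_sum {2}[v]tbasis_sum.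
pose g v' : {linear U -> W} := HB.pack (f^~ v') (GRing.isLinear.Build _ _ _ _ _ (fl v')).
pose h u' : {linear V -> W} := HB.pack (f u') (GRing.isLinear.Build _ _ _ _ _ (fr u')).
rewrite -[f _ _]/(g _ _) linear_sum /tlift; apply: eq_bigr => i _.
rewrite linearZ /= -[f _ _]/(h _ _) linear_sum scaler_sumr.
apply: eq_bigr => j _; rewrite linearZ /= scalerA; congr (_ *: _).
by rewrite !mxE big_ord1 !mxE.
Qed.

Lemma tens_rowE (t : tens U V) :
  t = \sum_i tbasis i *t r2v (row i (t : 'M[K]_(dim U, dim V))).
Proof.
apply/matrixP => i j; rewrite summxE (bigD1 i) //= big1 ?addr0.
  by rewrite /tpure !r2vK !mxE big_ord1 !mxE !eqxx mul1r.
by move=> k /negPf ki; rewrite /tpure !r2vK !mxE big_ord1 !mxE [i == k]eq_sym ki andbF mul0r.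
Qed.

Lemma tens_ind (P : tens U V -> Prop) :
  (forall u v, P (u *t v)) -> (forall s t, P s -> P t -> P (s + t)) ->
  forall t, P t.
Proof.
move=> Pp PD t; rewrite [t]tens_rowE.
have P0 : P 0 by rewrite -(scale0r (0 *t 0)) -tpureZl; apply: Pp.
by elim/big_ind: _ => // i _; apply: Pp.
Qed.
End TensorTheory.

Section TensorMaps.
Variable K : fieldType.
Definition tmap (U U' V V' : vectType K) (f : U -> U') (g : V -> V') : tens U V -> tens U' V' :=
  tlift (fun u v => f u *t g v).

Definition tassoc (U V W : vectType K) : tens (tens U V) W -> tens U (tens V W) :=
  tlift (fun t w => tlift (fun u v => u *t (v *t w)) t).

Definition tassocV (U V W : vectType K) : tens U (tens V W) -> tens (tens U V) W :=
  tlift (fun u => tlift (fun v w => (u *t v) *t w)).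

(* (a (x) b, a' (x) b') |-> m a a' (x) n b b' *)
Definition tmul2 (A A' A'' B B' B'' : vectType K) (m : A -> A' -> A'') (n : B -> B' -> B'')
    (s : tens A B) (t : tens A' B') : tens A'' B'' :=
  tlift (fun a b => tlift (fun a' b' => m a a' *t n b b') t) s.
End TensorMaps.
HB.instance Definition _ (K : fieldType) (U U' V V' : vectType K) (f : U -> U') (g : V -> V') :=
  GRing.Linear.copy (tmap f g) (tlift (fun u v => f u *t g v)).
HB.instance Definition _ (K : fieldType) (U V W : vectType K) :=
  GRing.Linear.copy (@tassoc K U V W) (tlift _).
HB.instance Definition _ (K : fieldType) (U V W : vectType K) :=
  GRing.Linear.copy (@tassocV K U V W) (tlift _).

Lemma linear_tlift (K : fieldType) (U V W X : vectType K) (F : X -> U -> V -> W) t :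
  (forall u v, linear (fun x => F x u v)) -> linear (fun x => tlift (F x) t).
Proof.
move=> FP a x y /=; rewrite /tlift scaler_sumr -big_split; apply: eq_bigr => i _ /=.
rewrite scaler_sumr -big_split; apply: eq_bigr => j _ /=.
by rewrite FP scalerDr !scalerA mulrC.
Qed.

Lemma tmul2_is_linear (K : fieldType) (A A' A'' B B' B'' : vectType K)
    (m : A -> A' -> A'') (n : B -> B' -> B'') s : linear (tmul2 m n s).
Proof.
by apply: linear_tlift => a b k t t'; rewrite linearP.
Qed.
HB.instance Definition _ (K : fieldType) (A A' A'' B B' B'' : vectType K)
    (m : A -> A' -> A'') (n : B -> B' -> B'') s :=
  GRing.isLinear.Build K (tens A' B') (tens A'' B'') _ (tmul2 m n s)
    (@tmul2_is_linear K A A' A'' B B' B'' m n s).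

Lemma bilin_tpure (K : fieldType) (U V : vectType K) : bilin (@tpure K U V).
Proof. by split=> ? a x y /=; rewrite ?(tpureDl, tpureDr, tpureZl, tpureZr). Qed.

Lemma bilin_mul (K : fieldType) (A : falgType K) : bilin ( *%R : A -> A -> A).
Proof.
by split=> ? a x y /=; rewrite (mulrDl, mulrDr) -?scalerAl -?scalerAr.
Qed.

Section TensorEqs.
Variable K : fieldType.

Lemma tmapE (U U' V V' : vectType K) (f : {linear U -> U'}) (g : {linear V -> V'}) u v :
  tmap f g (u *t v) = f u *t g v.
Proof.
rewrite /tmap tliftE //; split=> ? a x y /=; rewrite linearP;
by rewrite ?(tpureDl, tpureDr, tpureZl, tpureZr).
Qed.

Lemma tassocE (U V W : vectType K) (u : U) (v : V) (w : W) :
  tassoc ((u *t v) *t w) = u *t (v *t w).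
Proof.
rewrite /tassoc tliftE; last first.
  split=> [z|t]; first by move=> a x y /=; rewrite linearP.
  by apply: linear_tlift => ? ? a x y; rewrite !(tpureDr, tpureZr).
by rewrite tliftE //; split=> ? a x y; rewrite ?(tpureDl, tpureZl, tpureDr, tpureZr).
Qed.

Lemma tassocVE (U V W : vectType K) (u : U) (v : V) (w : W) :
  tassocV (u *t (v *t w)) = (u *t v) *t w.
Proof.
rewrite /tassocV tliftE; last first.
  split=> [z|t]; last by move=> a x y /=; rewrite linearP.
  by apply: linear_tlift => ? ? a x y; rewrite !(tpureDr, tpureZr, tpureDl, tpureZl).
by rewrite tliftE //; split=> ? a x y; rewrite ?(tpureDl, tpureZl, tpureDr, tpureZr).
Qed.

Section Mul2.
Variables (A A' A'' B B' B'' : vectType K).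
Variables (m : A -> A' -> A'') (n : B -> B' -> B'').
Lemma tmul2Dl s s' t : tmul2 m n (s + s') t = tmul2 m n s t + tmul2 m n s' t.
Proof. by rewrite /tmul2 linearD. Qed.
Lemma tmul2Zl k s t : tmul2 m n (k *: s) t = k *: tmul2 m n s t.
Proof. by rewrite /tmul2 linearZ. Qed.
Lemma tmul2E a b a' b' : bilin m -> bilin n ->
  tmul2 m n (a *t b) (a' *t b') = m a a' *t n b b'.
Proof.
move=> [ml mr] [nl nr].
rewrite /tmul2 tliftE; last first.
  split=> z; apply: linear_tlift => ? ? c x y /=; rewrite (ml, nl);
  by rewrite ?(tpureDl, tpureZl, tpureDr, tpureZr).
rewrite tliftE //; split=> ? c x y /=; rewrite (mr, nr);
by rewrite ?(tpureDl, tpureZl, tpureDr, tpureZr).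
Qed.
Lemma bilin_tmul2 : bilin (tmul2 m n).
Proof. by split=> t a x y /=; rewrite ?tmul2Dl ?tmul2Zl // linearP. Qed.
End Mul2.

Lemma tmap_id (U V : vectType K) (t : tens U V) : tmap idfun idfun t = t.
Proof. by elim/tens_ind: t => [u v|s t IHs IHt]; rewrite ?tmapE // linearD /= IHs IHt. Qed.

Lemma tmap_comp (U U' U'' V V' V'' : vectType K) (f : {linear U -> U'})
    (f' : {linear U' -> U''}) (g : {linear V -> V'}) (g' : {linear V' -> V''}) t :
  tmap f' g' (tmap f g t) = tmap (f' \o f) (g' \o g) t.
Proof. by elim/tens_ind: t => [u v|s t IHs IHt]; rewrite ?tmapE // !linearD /= IHs IHt. Qed.

Lemma eq_tmap (U U' V V' : vectType K) (f f' : U -> U') (g g' : V -> V') t :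
  f =1 f' -> g =1 g' -> tmap f g t = tmap f' g' t.
Proof. by move=> /funext-> /funext->. Qed.

End TensorEqs.

Section TensorAdd.
Variable K : fieldType.
Lemma tmapD (U U' V V' : vectType K) (f : U -> U') (g : V -> V') s t :
  tmap f g (s + t) = tmap f g s + tmap f g t.
Proof. exact: linearD. Qed.
Lemma tassocD (U V W : vectType K) s t :
  @tassoc K U V W (s + t) = tassoc s + tassoc t.
Proof. exact: linearD. Qed.
Lemma tassocVD (U V W : vectType K) s t :
  @tassocV K U V W (s + t) = tassocV s + tassocV t.
Proof. exact: linearD. Qed.
Lemma tmul2Dr (A A' A'' B B' B'' : vectType K) (m : A -> A' -> A'')
    (n : B -> B' -> B'') s t t' :
  tmul2 m n s (t + t') = tmul2 m n s t + tmul2 m n s t'.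
Proof. exact: linearD. Qed.
Definition tensD := (tmapD, tassocD, tassocVD, tmul2Dl, tmul2Dr, tpureDl, tpureDr).
End TensorAdd.

Section TensorAlg.
Variables (K : fieldType) (A B : falgType K).

Definition tens_mul (s t : tens A B) : tens A B := tmul2 *%R *%R s t.
Definition tens_one : tens A B := 1 *t 1.

Lemma tens_mulE a b a' b' :
  tens_mul (a *t b) (a' *t b') = (a * a') *t (b * b').
Proof. by rewrite /tens_mul tmul2E //; apply: bilin_mul. Qed.

Lemma tens_mulDl : left_distributive tens_mul +%R.
Proof. by move=> s t u; rewrite /tens_mul tmul2Dl. Qed.
Lemma tens_mulDr : right_distributive tens_mul +%R.
Proof. by move=> s t u; rewrite /tens_mul linearD. Qed.
Lemma tens_mulA : associative tens_mul.
Proof.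
move=> s t u.
elim/tens_ind: s => [a b|s s' IH IH']; last by rewrite !tens_mulDl IH IH'.
elim/tens_ind: t => [a' b'|t t' IH IH']; last by rewrite !(tens_mulDl, tens_mulDr) IH IH'.
elim/tens_ind: u => [a'' b''|u u' IH IH']; last by rewrite !tens_mulDr IH IH'.
by rewrite !tens_mulE !mulrA.
Qed.
Lemma tens_mul1l : left_id tens_one tens_mul.
Proof.
by elim/tens_ind=> [a b|s t IHs IHt]; rewrite ?tens_mulDr ?IHs ?IHt // tens_mulE !mul1r.
Qed.
Lemma tens_mul1r : right_id tens_one tens_mul.
Proof.
by elim/tens_ind=> [a b|s t IHs IHt]; rewrite ?tens_mulDl ?IHs ?IHt // tens_mulE !mulr1.
Qed.
Lemma tpure_neq0 (a : A) (b : B) : a != 0 -> b != 0 -> a *t b != 0.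
Proof.
have nz (U : vectType K) (u : U) : u != 0 -> exists i, v2r u 0 i != 0.
  by rewrite -(inj_eq (@v2r_inj K U)) linear0 => /rV0Pn.
move=> /nz[i ai] /nz[j bj]; apply/eqP => /matrixP/(_ i j).
rewrite !mxE big_ord1 !mxE => /eqP.
by rewrite mulf_eq0 (negPf ai) (negPf bj).
Qed.
Lemma tens_one_neq0 : tens_one != 0.
Proof. by apply: tpure_neq0; apply: oner_neq0. Qed.

HB.instance Definition _ := GRing.Zmodule_isNzRing.Build (tens A B)
  tens_mulA tens_mul1l tens_mul1r tens_mulDl tens_mulDr tens_one_neq0.

Lemma tens_scaleAl k (s t : tens A B) : k *: (s * t) = (k *: s) * t.
Proof. by rewrite -[RHS]/(tmul2 _ _ _ _) tmul2Zl. Qed.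
HB.instance Definition _ := GRing.Lmodule_isLalgebra.Build K (tens A B) tens_scaleAl.
Lemma tens_scaleAr k (s t : tens A B) : k *: (s * t) = s * (k *: t).
Proof. by rewrite -[RHS]/(tmul2 _ _ _ _) linearZ. Qed.
HB.instance Definition _ := GRing.Lalgebra_isAlgebra.Build K (tens A B) tens_scaleAr.
HB.instance Definition _ := Algebra_isFalgebra.Build K (tens A B).

Lemma tpureM (a a' : A) (b b' : B) : (a *t b) * (a' *t b') = (a * a') *t (b * b').
Proof. exact: tens_mulE. Qed.
Lemma tpure1 : 1 *t 1 = 1 :> tens A B.
Proof. by []. Qed.
End TensorAlg.

Section TensorNat.
Variable K : fieldType.

Lemma tassoc_nat (U U' V V' W W' : vectType K) (f : {linear U -> U'})
    (g : {linear V -> V'}) (h : {linear W -> W'}) t :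
  tassoc (tmap (tmap f g) h t) = tmap f (tmap g h) (tassoc t).
Proof.
elim/tens_ind: t => [p w|s t IHs IHt]; last by rewrite !linearD /= IHs IHt.
rewrite tmapE /=; elim/tens_ind: p => [u v|s t IHs IHt].
  by rewrite /= tmapE !tassocE !tmapE /= tmapE.
by rewrite !linearD /= !tpureDl !linearD /= IHs IHt.
Qed.

Lemma tassocVK (U V W : vectType K) : cancel (@tassocV K U V W) (@tassoc K U V W).
Proof.
elim/tens_ind=> [u p|s t IHs IHt]; last by rewrite !linearD /= IHs IHt.
elim/tens_ind: p => [v w|s t IHs IHt]; first by rewrite tassocVE tassocE.
by rewrite !tpureDr !linearD /= IHs IHt.
Qed.

Lemma tassocK (U V W : vectType K) : cancel (@tassoc K U V W) (@tassocV K U V W).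
Proof.
elim/tens_ind=> [p w|s t IHs IHt]; last by rewrite !linearD /= IHs IHt.
elim/tens_ind: p => [u v|s t IHs IHt]; first by rewrite tassocE tassocVE.
by rewrite !tpureDl !linearD /= IHs IHt.
Qed.

Lemma tmap_is_monoid_morphism (A A' B B' : falgType K)
    (f : {lrmorphism A -> A'}) (g : {lrmorphism B -> B'}) :
  monoid_morphism (tmap f g).
Proof.
split; first by rewrite -!tpure1 tmapE !rmorph1.
move=> s t; elim/tens_ind: s => [a b|s s' IH IH']; last by rewrite mulrDl !linearD /= IH IH' mulrDl.
elim/tens_ind: t => [a' b'|s s' IH IH']; last by rewrite mulrDr !linearD /= IH IH' mulrDr.
by rewrite tpureM !tmapE tpureM !rmorphM.
Qed.

Lemma tassoc_is_monoid_morphism (A B C : falgType K) :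
  monoid_morphism (@tassoc K A B C).
Proof.
split; first by rewrite -!tpure1 tassocE.
move=> s t; elim/tens_ind: s => [p c|s s' IH IH']; last by rewrite mulrDl !linearD /= IH IH' mulrDl.
elim/tens_ind: t => [p' c'|s s' IH IH']; last by rewrite mulrDr !linearD /= IH IH' mulrDr.
rewrite tpureM.
elim/tens_ind: p => [a b|s s' IH IH']; last by rewrite mulrDl !tpureDl !linearD /= IH IH' mulrDl.
elim/tens_ind: p' => [a' b'|s s' IH IH']; last by rewrite mulrDr !tpureDl !linearD /= IH IH' mulrDr.
by rewrite tpureM !tassocE !tpureM.
Qed.

Lemma tassocV_is_monoid_morphism (A B C : falgType K) :
  monoid_morphism (@tassocV K A B C).
Proof.
have [t1 tM] := tassoc_is_monoid_morphism A B C.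
split=> [|s t]; first by rewrite -t1 tassocK.
by rewrite -{1}[s]tassocVK -{1}[t]tassocVK -tM tassocK.
Qed.

Lemma tens_kerr (X U Z : vectType K) (D : {linear U -> Z}) (W : {vspace U}) (t : tens X U) :
  (forall u, D u = 0 -> u \in W) -> tmap idfun D t = 0 ->
  tmap idfun vsval (tmap idfun (vsproj W) t) = t.
Proof.
move=> DW; rewrite {1}[t]tens_rowE linear_sum /=.
under eq_bigr do rewrite tmapE /=.
move=> e; rewrite tmap_comp [in RHS](tens_rowE t) {1}[t]tens_rowE linear_sum /=.
apply: eq_bigr => i _; rewrite tmapE /= vsprojK //; apply/DW/v2r_inj/rowP => j.
move/matrixP/(_ i j): e; rewrite summxE (bigD1 i) //= big1 ?addr0.
  by rewrite /tpure !r2vK !mxE big_ord1 !mxE !eqxx mul1r linear0 mxE.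
by move=> k /negPf ki; rewrite /tpure !r2vK !mxE big_ord1 !mxE [i == k]eq_sym ki andbF mul0r.
Qed.

Lemma tens_colE (U V : vectType K) (t : tens U V) :
  t = \sum_j r2v (col j (t : 'M[K]_(dim U, dim V)))^T *t tbasis j.
Proof.
apply/matrixP => i j; rewrite summxE (bigD1 j) //= big1 ?addr0.
  by rewrite /tpure !r2vK !mxE big_ord1 !mxE !eqxx mulr1.
by move=> k /negPf ki; rewrite /tpure !r2vK !mxE big_ord1 !mxE [j == k]eq_sym ki andbF mulr0.
Qed.

Lemma tens_kerl (X U Z : vectType K) (D : {linear U -> Z}) (W : {vspace U}) (t : tens U X) :
  (forall u, D u = 0 -> u \in W) -> tmap D idfun t = 0 ->
  tmap vsval idfun (tmap (vsproj W) idfun t) = t.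
Proof.
move=> DW; rewrite {1}[t]tens_colE linear_sum /=.
under eq_bigr do rewrite tmapE /=.
move=> e; rewrite tmap_comp [in RHS](tens_colE t) {1}[t]tens_colE linear_sum /=.
apply: eq_bigr => i _; rewrite tmapE /= vsprojK //; apply/DW/v2r_inj/rowP => j.
move/matrixP/(_ j i): e; rewrite summxE (bigD1 i) //= big1 ?addr0.
  by rewrite /tpure !r2vK !mxE big_ord1 !mxE !eqxx mulr1 linear0 mxE.
by move=> k /negPf ki; rewrite /tpure !r2vK !mxE big_ord1 !mxE [i == k]eq_sym ki andbF mulr0.
Qed.

Lemma tmap_injr (X U V : vectType K) (f : {linear U -> V}) (g : {linear V -> U}) :
  cancel f g -> injective (tmap (idfun : X -> X) f).
Proof.
move=> fK; apply: (can_inj (g := tmap idfun g)) => t.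
by rewrite tmap_comp -[RHS]tmap_id; apply: eq_tmap => x //=; rewrite fK.
Qed.
Lemma tmap_injl (X U V : vectType K) (f : {linear U -> V}) (g : {linear V -> U}) :
  cancel f g -> injective (tmap f (idfun : X -> X)).
Proof.
move=> fK; apply: (can_inj (g := tmap g idfun)) => t.
by rewrite tmap_comp -[RHS]tmap_id; apply: eq_tmap => x //=; rewrite fK.
Qed.
End TensorNat.

HB.instance Definition _ (K : fieldType) (A A' B B' : falgType K)
    (f : {lrmorphism A -> A'}) (g : {lrmorphism B -> B'}) :=
  GRing.isMonoidMorphism.Build (tens A B) (tens A' B') (tmap f g)
    (tmap_is_monoid_morphism f g).
HB.instance Definition _ (K : fieldType) (A B C : falgType K) :=
  GRing.isMonoidMorphism.Build _ _ (@tassoc K A B C)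
    (tassoc_is_monoid_morphism A B C).
HB.instance Definition _ (K : fieldType) (A B C : falgType K) :=
  GRing.isMonoidMorphism.Build _ _ (@tassocV K A B C)
    (tassocV_is_monoid_morphism A B C).

(* u (x) v |-> p u *: v, resp. p v *: u *)
Definition tevall (K : fieldType) (U V : vectType K) (p : U -> K) : tens U V -> V :=
  tlift (fun u v => p u *: v).
Definition tevalr (K : fieldType) (U V : vectType K) (p : V -> K) : tens U V -> U :=
  tlift (fun u v => p v *: u).
HB.instance Definition _ (K : fieldType) (U V : vectType K) (p : U -> K) :=
  GRing.Linear.copy (@tevall K U V p) (tlift _).
HB.instance Definition _ (K : fieldType) (U V : vectType K) (p : V -> K) :=
  GRing.Linear.copy (@tevalr K U V p) (tlift _).

Lemma tevallE (K : fieldType) (U V : vectType K) (p : {linear U -> K^o}) (u : U) (v : V) :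
  tevall p (u *t v) = p u *: v.
Proof.
rewrite /tevall tliftE //; split=> z a x y /=.
  by rewrite linearP scalerDl scalerA.
by rewrite scalerDr !scalerA mulrC.
Qed.
Lemma tevalrE (K : fieldType) (U V : vectType K) (p : {linear V -> K^o}) (u : U) (v : V) :
  tevalr p (u *t v) = p v *: u.
Proof.
rewrite /tevalr tliftE //; split=> z a x y /=.
  by rewrite scalerDr !scalerA mulrC.
by rewrite linearP scalerDl scalerA.
Qed.

Record hopfAlg (K : fieldType) := HopfAlg {
  hopf_alg :> falgType K;
  comul : {lrmorphism hopf_alg -> tens hopf_alg hopf_alg};
  counit : {lrmorphism hopf_alg -> K^o};
  antipode : {linear hopf_alg -> hopf_alg};
  comulA : forall h, tassoc (tmap comul idfun (comul h)) = tmap idfun comul (comul h);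
  counitl : forall h, tevall counit (comul h) = h;
  counitr : forall h, tevalr counit (comul h) = h;
  antipodel : forall h, tlift (fun a b => antipode a * b) (comul h) = (counit h : K)%:A;
  antipoder : forall h, tlift (fun a b => a * antipode b) (comul h) = (counit h : K)%:A }.
Arguments comul {K} _.
Arguments counit {K} _.
Arguments antipode {K} _.

Record comod (K : fieldType) (H : hopfAlg K) := Comod {
  comod_vect :> vectType K;
  coact : {linear comod_vect -> tens H comod_vect};
  coactA : forall x, tassoc (tmap (comul H) idfun (coact x)) = tmap idfun coact (coact x);
  coact1 : forall x, tevall (counit H) (coact x) = x }.
Arguments coact {K H _}.

Definition colinear (K : fieldType) (H : hopfAlg K) (X Y : comod H) (f : X -> Y) :=
  forall x, coact (f x) = tmap idfun f (coact x).

Definition comod_iso (K : fieldType) (H : hopfAlg K) (X Y : comod H)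
    (f : {linear X -> Y}) := bijective f /\ colinear f.

Section ComodTensor.
Variables (K : fieldType) (H : hopfAlg K) (X Y : comod H).

Definition comod_tens_coact : tens X Y -> tens H (tens X Y) :=
  tlift (fun x y => tmul2 *%R (@tpure K X Y) (coact x) (coact y)).
HB.instance Definition _ := GRing.Linear.copy comod_tens_coact (tlift _).

Lemma comod_tens_coactE x y :
  comod_tens_coact (x *t y) = tmul2 *%R (@tpure K X Y) (coact x) (coact y).
Proof.
rewrite /comod_tens_coact tliftE //; split=> z a u v /=.
  by rewrite linearP tmul2Dl tmul2Zl.
by rewrite !linearP.
Qed.

Lemma comod_tens_coactA t :
  tassoc (tmap (comul H) idfun (comod_tens_coact t)) =
  tmap idfun comod_tens_coact (comod_tens_coact t).
Proof.
have bm := bilin_mul H; have bp := bilin_tpure X Y.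
pose M := tmul2 ( *%R : H -> H -> H) (tmul2 ( *%R : H -> H -> H) (@tpure K X Y)).
have bmp : bilin (tmul2 ( *%R : H -> H -> H) (@tpure K X Y)) by apply: bilin_tmul2.
elim/tens_ind: t => [x y|s t IHs IHt]; last by rewrite !linearD /= IHs IHt.
rewrite !comod_tens_coactE.
transitivity (M (tassoc (tmap (comul H) idfun (coact x))) (tassoc (tmap (comul H) idfun (coact y)))).
  elim/tens_ind: (coact x) => [h x'|s t IHs IHt]; last by rewrite /M !tensD IHs IHt.
  elim/tens_ind: (coact y) => [k y'|s t IHs IHt]; last by rewrite /M !tensD IHs IHt.
  rewrite tmul2E // !tmapE /= rmorphM /=.
  elim/tens_ind: (comul H h) => [h1 h2|s t IHs IHt]; last by rewrite /M mulrDl !tensD IHs IHt.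
  elim/tens_ind: (comul H k) => [k1 k2|s t IHs IHt]; last by rewrite /M mulrDr !tensD IHs IHt.
  by rewrite tpureM !tassocE /M !tmul2E.
rewrite !coactA.
elim/tens_ind: (coact x) => [h x'|s t IHs IHt]; last by rewrite /M !tensD -IHs -IHt.
elim/tens_ind: (coact y) => [k y'|s t IHs IHt]; last by rewrite /M !tensD -IHs -IHt.
by rewrite tmul2E // !tmapE /M !tmul2E //= comod_tens_coactE.
Qed.

Lemma comod_tens_coact1 t : tevall (counit H) (comod_tens_coact t) = t.
Proof.
have bm := bilin_mul H; have bp := bilin_tpure X Y.
elim/tens_ind: t => [x y|s t IHs IHt]; last by rewrite !linearD /= IHs IHt.
rewrite comod_tens_coactE -{2}[x]coact1 -{2}[y]coact1.
elim/tens_ind: (coact x) => [h x'|s t IHs IHt]; last first.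
  by rewrite tmul2Dl !linearD /= IHs IHt tpureDl.
elim/tens_ind: (coact y) => [k y'|s t IHs IHt]; last first.
  by rewrite !linearD /= IHs IHt tpureDr.
by rewrite tmul2E // !tevallE /= rmorphM tpureZl tpureZr scalerA.
Qed.

Definition comod_tens : comod H := Comod comod_tens_coactA comod_tens_coact1.
End ComodTensor.

Section GroupLike.
Variables (K : fieldType) (H : hopfAlg K).

Definition grouplike (g : H) : bool := ((comul H) g == g *t g) && ((counit H) g == 1).
Definition grouplikes : Type := {g : H | grouplike g}.
HB.instance Definition _ := Choice.on grouplikes.

Lemma grouplikeP (g : grouplikes) : (comul H) (val g) = val g *t val g /\ (counit H) (val g) = 1.
Proof. by case/andP: (valP g) => /eqP ? /eqP. Qed.

Lemma grouplike1_subproof : grouplike 1.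
Proof. by rewrite /grouplike !rmorph1 !eqxx. Qed.
Definition grouplike1 : grouplikes := exist _ 1 grouplike1_subproof.

Lemma grouplike_unit (g : grouplikes) : val g \is a GRing.unit.
Proof.
have [gD ge] := grouplikeP g.
have bS : bilin (fun a b : H => antipode H a * b) /\ bilin (fun a b : H => a * antipode H b).
  by split; split=> z a x y /=; rewrite ?linearP (mulrDl, mulrDr) -?scalerAl -?scalerAr.
apply/unitrP; exists (antipode H (val g)).
have := antipodel (val g); have := antipoder (val g); rewrite gD ge !tliftE ?scale1r //; by case: bS.
Qed.

(* k_g is K^o with the coaction c |-> g (x) c. *)
Definition kg_coact (g : H) (c : K^o) : tens H K^o := g *t c.
Lemma kg_coact_is_linear g : linear (kg_coact g).
Proof. by move=> a x y; rewrite /kg_coact tpureDr tpureZr. Qed.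
HB.instance Definition _ g := GRing.isLinear.Build K K^o (tens H K^o) _ (kg_coact g)
  (kg_coact_is_linear g).
Variable g : grouplikes.
Lemma kg_coactA c : tassoc (tmap (comul H) idfun (kg_coact (val g) c)) =
  tmap idfun (kg_coact (val g)) (kg_coact (val g) c).
Proof. by rewrite -[kg_coact _ c]/(val g *t c) !tmapE /= (grouplikeP g).1 tassocE. Qed.
Lemma kg_coact1 c : tevall (counit H) (kg_coact (val g) c) = c.
Proof. by rewrite /kg_coact tevallE /= (grouplikeP g).2 scale1r. Qed.
Definition kg : comod H := Comod kg_coactA kg_coact1.
End GroupLike.

Record bicomodAlg (K : fieldType) (H : hopfAlg K) := BicomodAlg {
  bc_alg :> falgType K;
  lco : {lrmorphism bc_alg -> tens H bc_alg};
  rco : {lrmorphism bc_alg -> tens bc_alg H};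
  lcoA : forall x, tassoc (tmap (comul H) idfun (lco x)) = tmap idfun lco (lco x);
  lco1 : forall x, tevall (counit H) (lco x) = x;
  rcoA : forall x, tassoc (tmap rco idfun (rco x)) = tmap idfun (comul H) (rco x);
  rco1 : forall x, tevalr (counit H) (rco x) = x;
  lrco : forall x, tassoc (tmap lco idfun (rco x)) = tmap idfun rco (lco x) }.
Arguments lco {K H} _.
Arguments rco {K H} _.

Definition lcomod (K : fieldType) (H : hopfAlg K) (L : bicomodAlg H) : comod H :=
  Comod (@lcoA K H L) (@lco1 K H L).

Definition regbc (K : fieldType) (H : hopfAlg K) : bicomodAlg H :=
  BicomodAlg (@comulA K H) (@counitl K H) (@comulA K H) (@counitr K H) (@comulA K H).

Record bicomodAlg_iso (K : fieldType) (H : hopfAlg K) (A B : bicomodAlg H)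
    (f : {lrmorphism A -> B}) : Prop := BicomodAlgIso {
  bci_bij : bijective f;
  bci_lco : forall x, lco B (f x) = tmap idfun f (lco A x);
  bci_rco : forall x, rco B (f x) = tmap f idfun (rco A x) }.

(* The Galois maps are a (x) b |-> (1 (x) a) lambda(b) on the left and
   a (x) b |-> (a (x) 1) rho(b) on the right. *)
Record leftGalois (K : fieldType) (H : hopfAlg K) (A : bicomodAlg H) : Prop := LeftGalois {
  lgal_coinv : forall x : A, lco A x = 1 *t x <-> exists k : K, x = k%:A;
  lgal_bij : bijective (tlift (fun a b : A => (1 *t a) * lco A b)) }.

Record rightGalois (K : fieldType) (H : hopfAlg K) (A : bicomodAlg H) : Prop := RightGalois {
  rgal_coinv : forall x : A, rco A x = x *t 1 <-> exists k : K, x = k%:A;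
  rgal_bij : bijective (tlift (fun a b : A => (a *t 1) * rco A b)) }.

Definition biGalois (K : fieldType) (H : hopfAlg K) (A : bicomodAlg H) : Prop :=
  leftGalois A /\ rightGalois A.

(* L^g: the left coaction becomes a |-> g^{-1} a_{-1} g (x) a_0. *)
Section Twist.
Variables (K : fieldType) (H : hopfAlg K) (L : bicomodAlg H) (g : grouplikes H).

Definition conjV (h : H) : H := (val g)^-1 * h * val g.
Lemma conjV_is_linear : linear conjV.
Proof. by move=> a x y; rewrite /conjV mulrDr mulrDl -scalerAr -scalerAl. Qed.
HB.instance Definition _ := GRing.isLinear.Build K H H _ conjV conjV_is_linear.
Lemma conjV_is_monoid_morphism : monoid_morphism conjV.
Proof.
have gu := grouplike_unit g.
split=> [|x y]; first by rewrite /conjV mulr1 mulVr.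
by rewrite /conjV !mulrA mulrK.
Qed.
HB.instance Definition _ := GRing.isMonoidMorphism.Build H H conjV conjV_is_monoid_morphism.

Definition twist_lco : L -> tens H L := tmap conjV idfun \o lco L.
HB.instance Definition _ := GRing.LRMorphism.on twist_lco.

Lemma comul_conjV h : (comul H) (conjV h) = tmap conjV conjV ((comul H) h).
Proof.
have gu := grouplike_unit g.
rewrite {1}/conjV !rmorphM /= rmorphV //= (grouplikeP g).1.
have -> : (val g *t val g)^-1 = (val g)^-1 *t (val g)^-1.
  by apply: (mulrI (x := val g *t val g)); rewrite ?divrr ?tpureM ?divrr ?tpure1 //;
   apply/unitrP; exists ((val g)^-1 *t (val g)^-1); rewrite !tpureM divrr // mulVr.
elim/tens_ind: (comul H h) => [x y|s t IHs IHt]; first by rewrite !tpureM tmapE.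
by rewrite mulrDr mulrDl IHs IHt -tmapD.
Qed.
Lemma counit_conjV h : counit H (conjV h) = counit H h.
Proof.
by rewrite /conjV !rmorphM /= rmorphV ?grouplike_unit //= (grouplikeP g).2 invr1 mul1r mulr1.
Qed.

Lemma twist_lcoA x :
  tassoc (tmap (comul H) idfun (twist_lco x)) = tmap idfun twist_lco (twist_lco x).
Proof.
rewrite -[twist_lco x]/(tmap conjV idfun (lco L x)).
have -> : tmap idfun twist_lco (tmap conjV idfun (lco L x)) =
    tmap conjV (tmap conjV idfun) (tmap idfun (lco L) (lco L x)).
  by rewrite !tmap_comp; apply: eq_tmap.
rewrite -lcoA -tassoc_nat !tmap_comp; congr tassoc.
by apply: eq_tmap => // y; apply: comul_conjV.
Qed.
Lemma twist_lco1 x : tevall (counit H) (twist_lco x) = x.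
Proof.
rewrite -[RHS](lco1 x) /twist_lco /=.
elim/tens_ind: (lco L x) => [h y|s t IHs IHt]; last by rewrite !linearD /= IHs IHt.
by rewrite tmapE !tevallE /= counit_conjV.
Qed.
Lemma twist_lrco x :
  tassoc (tmap twist_lco idfun (rco L x)) = tmap idfun (rco L) (twist_lco x).
Proof.
rewrite -[twist_lco x]/(tmap conjV idfun (lco L x)).
have -> : tmap idfun (rco L) (tmap conjV idfun (lco L x)) =
    tmap conjV (tmap idfun idfun) (tmap idfun (rco L) (lco L x)).
  by rewrite !tmap_comp; apply: eq_tmap => // y; rewrite /= tmap_id.
rewrite -lrco -tassoc_nat !tmap_comp; congr tassoc.
Qed.
Definition twist : bicomodAlg H :=
  BicomodAlg twist_lcoA twist_lco1 (@rcoA K H L) (@rco1 K H L) twist_lrco.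

End Twist.

Section Cotensor.
Variables (K : fieldType) (H : hopfAlg K) (L : bicomodAlg H) (X : comod H).

Definition cot_diff (t : tens L X) : tens L (tens H X) :=
  tassoc (tmap (rco L) idfun t) - tmap idfun coact t.
Lemma cot_diff_is_linear : linear cot_diff.
Proof.
move=> a s t; rewrite /cot_diff.
have /= -> := linearP (@tassoc K L H X \o tmap (rco L) idfun) a s t.
have /= -> := linearP (tmap (idfun : L -> L) (@coact _ _ X)) a s t.
by rewrite scalerBr opprD addrACA.
Qed.
HB.instance Definition _ := GRing.isLinear.Build K _ _ _ cot_diff cot_diff_is_linear.

(* L [] X is the kernel of rho_L (x) id - id (x) lambda_X. *)
Definition cot_space : {vspace tens L X} := lker (linfun cot_diff).

Lemma mem_cot t : reflect (tassoc (tmap (rco L) idfun t) = tmap idfun coact t) (t \in cot_space).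
Proof. by rewrite memv_ker lfunE /= subr_eq0; apply: eqP. Qed.

Notation cotT := (subvs_of cot_space).

Definition cot_Lambda (t : tens L X) : tens H (tens L X) := tassoc (tmap (lco L) idfun t).
HB.instance Definition _ := GRing.Linear.copy cot_Lambda (@tassoc K H L X \o tmap (lco L) idfun).

Lemma cot_LambdaE x y : cot_Lambda (x *t y) = tassoc (lco L x *t y).
Proof. by rewrite /cot_Lambda tmapE. Qed.

Lemma cot_Lambda_diff t : t \in cot_space -> tmap idfun cot_diff (cot_Lambda t) = 0.
Proof.
move/mem_cot => e.
have subE : forall s : tens H (tens L X), tmap idfun cot_diff s =
    tmap idfun (fun t => tassoc (tmap (rco L) idfun t)) s - tmap idfun (tmap idfun coact) s.
  elim/tens_ind=> [h p|s s' IHs IHs']; last by rewrite !tmapD IHs IHs' opprD addrACA.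
  rewrite !(tmapE idfun) /=.
  rewrite -[tmap idfun _ (h *t p)]/(tmap idfun (@tassoc K L H X \o tmap (rco L) idfun) (h *t p)).
  by rewrite tmapE -[h *t cot_diff p]/(h *t (_ + _)) tpureDr -scaleN1r tpureZr scaleN1r.
rewrite subE; apply/eqP; rewrite subr_eq0; apply/eqP.
have -> : tmap idfun (tmap idfun coact) (cot_Lambda t) =
    tassoc (tmap (lco L) idfun (tmap idfun coact t)).
  rewrite /cot_Lambda -tassoc_nat; congr tassoc.
  by rewrite !tmap_comp; apply: eq_tmap => x //=; rewrite tmap_id.
rewrite -e {e}; elim/tens_ind: t => [x y|s s' IHs IHs']; last by rewrite /cot_Lambda !tensD IHs IHs'.
rewrite cot_LambdaE tmapE /=.
pose Q (w : tens H (tens L H)) := tmap idfun (@tassoc K L H X) (tassoc (w *t y)).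
transitivity (Q (tmap idfun (rco L) (lco L x))).
  rewrite /Q; elim/tens_ind: (lco L x) => [h x'|s s' IHs IHs']; last by rewrite !tensD IHs IHs'.
  rewrite tassocE tmapE tassocE !tmapE /=.
  rewrite -[tmap idfun _ _]/(tmap idfun (@tassoc K L H X \o tmap (rco L) idfun) (h *t (x' *t y))).
  by rewrite tmapE /= tmapE.
rewrite -lrco /Q; elim/tens_ind: (rco L x) => [x' h|s s' IHs IHs']; last by rewrite !tensD IHs IHs'.
rewrite tassocE !tmapE /=.
elim/tens_ind: (lco L x') => [k x''|s s' IHs IHs']; last by rewrite !tensD IHs IHs'.
by rewrite !tassocE tmapE /= tassocE.
Qed.

(* The left coaction of L, restricted to L [] X.  Its values lie in
   H (x) (L [] X) (see cot_coactE), so that vsproj, a projection onto the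
   subspace, only changes the type. *)
Definition cot_coact (t : cotT) : tens H cotT :=
  tmap idfun (vsproj cot_space) (cot_Lambda (vsval t)).
HB.instance Definition _ := GRing.Linear.copy cot_coact
  (tmap idfun (vsproj cot_space) \o cot_Lambda \o vsval).

Lemma cot_coactE t : tmap idfun vsval (cot_coact t) = cot_Lambda (vsval t).
Proof.
apply: (tens_kerr (D := cot_diff)); last by apply/cot_Lambda_diff/subvsP.
by move=> u /eqP; rewrite memv_ker lfunE.
Qed.

Lemma cot_coactA t :
  tassoc (tmap (comul H) idfun (cot_coact t)) = tmap idfun cot_coact (cot_coact t).
Proof.
apply: (tmap_injr (f := tmap idfun vsval) (g := tmap idfun (vsproj cot_space))).
  by move=> s; rewrite /= tmap_comp -[RHS]tmap_id; apply: eq_tmap => // u; apply: vsvalK.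
have -> : tmap idfun (tmap idfun vsval) (tmap idfun cot_coact (cot_coact t)) =
    tmap idfun (@cot_Lambda) (cot_Lambda (vsval t)).
  rewrite -cot_coactE (tmap_comp idfun idfun (@cot_coact) (tmap idfun vsval)).
  rewrite (tmap_comp idfun idfun vsval (@cot_Lambda)).
  by apply: eq_tmap => // u; apply: cot_coactE.
rewrite /= -tassoc_nat.
have -> : tmap (tmap idfun idfun) vsval (tmap (comul H) idfun (cot_coact t)) =
    tmap (comul H) idfun (cot_Lambda (vsval t)).
  rewrite -cot_coactE !tmap_comp. apply: eq_tmap => // x; apply: tmap_id.
elim/tens_ind: (vsval t) => [x y|s s' IHs IHs']; last by rewrite ![cot_Lambda _]linearD /= !tensD IHs IHs'.
rewrite !cot_LambdaE.
pose Q (w : tens H (tens H L)) := tmap idfun (@tassoc K H L X) (tassoc (w *t y)).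
transitivity (Q (tassoc (tmap (comul H) idfun (lco L x)))).
  rewrite /Q; elim/tens_ind: (lco L x) => [h x'|s s' IHs IHs']; last by rewrite !tensD IHs IHs'.
  rewrite tassocE !tmapE /=; elim/tens_ind: (comul H h) => [h1 h2|s s' IHs IHs']; last by rewrite !tensD IHs IHs'.
  by rewrite !tassocE tmapE /= tassocE.
rewrite lcoA /Q; elim/tens_ind: (lco L x) => [h x'|s s' IHs IHs']; last by rewrite !tensD IHs IHs'.
by rewrite tassocE !tmapE tassocE !tmapE /= cot_LambdaE.
Qed.

Lemma cot_coact1 t : tevall (counit H) (cot_coact t) = t.
Proof.
apply: subvs_inj.
have -> : vsval (tevall (counit H) (cot_coact t)) = tevall (counit H) (tmap idfun vsval (cot_coact t)).
  elim/tens_ind: (cot_coact t) => [h s|s s' IHs IHs']; last by rewrite !linearD /= IHs IHs'.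
  by rewrite tmapE !tevallE linearZ.
rewrite cot_coactE; elim/tens_ind: (vsval t) => [x y|s s' IHs IHs']; last by rewrite !linearD /= IHs IHs'.
rewrite cot_LambdaE -{2}(lco1 x).
elim/tens_ind: (lco L x) => [h x'|s s' IHs IHs']; last by rewrite tpureDl tassocD !linearD /= IHs IHs' tpureDl.
by rewrite tassocE !tevallE tpureZl.
Qed.

Definition cot : comod H := Comod cot_coactA cot_coact1.
End Cotensor.

(* A [] B as a bicomodule algebra, a subalgebra of A (x) B *)
Section CotensorAlg.
Variables (K : fieldType) (H : hopfAlg K) (A B : bicomodAlg H).
Let C := cot_space A (lcomod B).

Lemma mem_cota (t : tens A B) :
  reflect (tassoc (tmap (rco A) idfun t) = tmap idfun (lco B) t) (t \in (C : {vspace tens A B})).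
Proof. exact: (@mem_cot K H A (lcomod B)). Qed.

Lemma cot_is_aspace : is_aspace (C : {vspace tens A B}).
Proof.
rewrite /is_aspace has_algid1 /=; last first.
  by apply/mem_cota; rewrite !rmorph1.
apply/prodvP => s t /mem_cota es /mem_cota et; apply/mem_cota.
by rewrite !rmorphM /= es et.
Qed.
Definition cot_aspace : {aspace tens A B} := ASpace cot_is_aspace.

Notation cotT := (subvs_of cot_aspace).

Lemma cot_vsval1 : vsval (1 : cotT) = 1.
Proof.
have /eqP e : algid cot_aspace == 1.
  by rewrite algid_eq1; apply/mem_cota; rewrite !rmorph1.
exact: e.
Qed.
Lemma cot_vsval_is_monoid_morphism : monoid_morphism (vsval : cotT -> tens A B).
Proof. by split; [apply: cot_vsval1|]. Qed.
HB.instance Definition _ := GRing.isMonoidMorphism.Build cotT (tens A B) vsval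
  cot_vsval_is_monoid_morphism.

Definition cot_lco : cotT -> tens H cotT := @cot_coact K H A (lcomod B).
HB.instance Definition _ := GRing.Linear.copy cot_lco (@cot_coact K H A (lcomod B)).
Lemma cot_lcoE (t : cotT) : tmap idfun vsval (cot_lco t) = tassoc (tmap (lco A) idfun (vsval t)).
Proof. exact: (@cot_coactE K H A (lcomod B)). Qed.
Lemma cot_lco_is_monoid_morphism : monoid_morphism cot_lco.
Proof.
have inj : injective (tmap (idfun : H -> H) (vsval : cotT -> tens A B)).
  exact: (tmap_injr (@vsvalK _ _ cot_aspace)).
split=> [|s t]; apply: inj; first by rewrite cot_lcoE !rmorph1.
by rewrite [RHS]rmorphM /= !cot_lcoE !rmorphM.
Qed.
HB.instance Definition _ := GRing.isMonoidMorphism.Build cotT (tens H cotT) cot_lco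
  cot_lco_is_monoid_morphism.

Definition cot_rLambda (t : tens A B) : tens (tens A B) H := tassocV (tmap idfun (rco B) t).
HB.instance Definition _ := GRing.LRMorphism.copy cot_rLambda (@tassocV K A B H \o tmap idfun (rco B)).

Definition cot_rco (t : cotT) : tens cotT H :=
  tmap (vsproj cot_aspace) idfun (cot_rLambda (vsval t)).
HB.instance Definition _ := GRing.Linear.copy cot_rco
  (tmap (vsproj cot_aspace) idfun \o cot_rLambda \o vsval).

Lemma cot_rLambdaE x y : cot_rLambda (x *t y) = tassocV (x *t rco B y).
Proof. by rewrite /cot_rLambda tmapE. Qed.

Lemma cot_rLambdaD s t : cot_rLambda (s + t) = cot_rLambda s + cot_rLambda t.
Proof. exact: linearD. Qed.

Lemma cot_rLambda_diff t : t \in (C : {vspace tens A B}) ->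
  tmap (@cot_diff K H A (lcomod B)) idfun (cot_rLambda t) = 0.
Proof.
move/mem_cota => e.
pose D1 : {linear tens A B -> tens A (tens H B)} := @tassoc K A H B \o tmap (rco A) idfun.
pose D2 : {linear tens A B -> tens A (tens H B)} := tmap (idfun : A -> A) (lco B).
have subE : forall s : tens (tens A B) H, tmap (@cot_diff K H A (lcomod B)) idfun s =
    tmap D1 idfun s - tmap D2 idfun s.
  elim/tens_ind=> [p h|s s' IHs IHs']; last by rewrite !tmapD IHs IHs' opprD addrACA.
  rewrite !tmapE /=.
  have -> : cot_diff (p : tens A (lcomod B)) = D1 p - D2 p by [].
  by rewrite tpureDl -scaleN1r tpureZl scaleN1r.
rewrite subE; apply/eqP; rewrite subr_eq0; apply/eqP.
pose F (w : tens H B) : tens (tens H B) H := tassocV (tmap idfun (rco B) w).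
pose E (w : tens A (tens H B)) := tassocV (tmap idfun (@tassocV K H B H \o tmap idfun (rco B)) w).
have ED u v : E (u + v) = E u + E v by rewrite /E !tensD.
have EE x w : E (x *t w) = tassocV (x *t F w) by rewrite /E tmapE.
transitivity (E (tassoc (tmap (rco A) idfun t))).
  elim/tens_ind: t {e} => [x y|s s' IHs IHs']; last by rewrite cot_rLambdaD !tensD ED IHs IHs'.
  rewrite cot_rLambdaE tmapE /=.
  transitivity (tmap (@tassoc K A H B) idfun (tassocV (rco A x *t rco B y))).
    elim/tens_ind: (rco B y) => [y' k|s s' IHs IHs']; last by rewrite !tensD IHs IHs'.
    by rewrite !tassocVE !tmapE /= tmapE.
  elim/tens_ind: (rco A x) => [x' h|s s' IHs IHs']; last by rewrite !tensD ED IHs IHs'.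
  rewrite tassocE EE /F tmapE /=.
  elim/tens_ind: (rco B y) => [y' k|s s' IHs IHs']; last by rewrite !tensD IHs IHs'.
  by rewrite !tassocVE !tmapE /= tassocE.
rewrite e; elim/tens_ind: t {e} => [x y|s s' IHs IHs']; last by rewrite cot_rLambdaD !tensD ED IHs IHs'.
rewrite cot_rLambdaE tmapE EE /= /F -lrco tassocK.
elim/tens_ind: (rco B y) => [y' k|s s' IHs IHs']; last by rewrite !tensD IHs IHs'.
by rewrite !(tmapE, tassocVE) /= ?tassocVE tmapE.
Qed.

Lemma cot_rcoE (t : cotT) : tmap vsval idfun (cot_rco t) = cot_rLambda (vsval t).
Proof.
apply: (tens_kerl (D := @cot_diff K H A (lcomod B))); last first.
  exact: (cot_rLambda_diff (subvsP t)).
by move=> u /eqP u0; apply/mem_cota/eqP; rewrite -subr_eq0.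
Qed.

Lemma cot_rco_is_monoid_morphism : monoid_morphism cot_rco.
Proof.
have inj : injective (tmap (vsval : cotT -> tens A B) (idfun : H -> H)).
  exact: (tmap_injl (@vsvalK _ _ cot_aspace)).
split=> [|s t]; apply: inj; first by rewrite cot_rcoE !rmorph1.
by rewrite [RHS]rmorphM /= !cot_rcoE !rmorphM.
Qed.
HB.instance Definition _ := GRing.isMonoidMorphism.Build cotT (tens cotT H) cot_rco
  cot_rco_is_monoid_morphism.

Lemma cot_rcoA t : tassoc (tmap cot_rco idfun (cot_rco t)) = tmap idfun (comul H) (cot_rco t).
Proof.
apply: (tmap_injl (f := vsval) (g := vsproj cot_aspace)); first exact: vsvalK.
have -> : tmap vsval idfun (tmap idfun (comul H) (cot_rco t)) =
    tmap idfun (comul H) (cot_rLambda (vsval t)).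
  by rewrite -cot_rcoE !tmap_comp; apply: eq_tmap.
have -> : tmap vsval idfun (tassoc (tmap cot_rco idfun (cot_rco t))) =
    tassoc (tmap (@cot_rLambda) idfun (cot_rLambda (vsval t))).
  rewrite -cot_rcoE.
  transitivity (tmap vsval (tmap idfun idfun) (tassoc (tmap cot_rco idfun (cot_rco t)))).
    by apply: eq_tmap => // u; rewrite tmap_id.
  rewrite -tassoc_nat; congr tassoc; rewrite !tmap_comp.
  by apply: eq_tmap => // u; apply: cot_rcoE.
elim/tens_ind: (vsval t) => [x y|s s' IHs IHs']; last by rewrite cot_rLambdaD !tensD IHs IHs'.
rewrite cot_rLambdaE.
transitivity (tassocV (x *t tassoc (tmap (rco B) idfun (rco B y)))).
  elim/tens_ind: (rco B y) => [y' k|s s' IHs IHs']; last by rewrite !tensD IHs IHs'.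
  rewrite tassocVE !tmapE /= cot_rLambdaE.
  elim/tens_ind: (rco B y') => [y2 k2|s s' IHs IHs']; last by rewrite !tensD IHs IHs'.
  by rewrite tassocVE !tassocE tassocVE.
rewrite rcoA.
elim/tens_ind: (rco B y) => [y' k|s s' IHs IHs']; last by rewrite !tensD IHs IHs'.
by rewrite !(tmapE, tassocVE) /= ?tassocVE.
Qed.

Lemma cot_rco1 t : tevalr (counit H) (cot_rco t) = t.
Proof.
apply: subvs_inj.
have -> : vsval (tevalr (counit H) (cot_rco t)) = tevalr (counit H) (tmap vsval idfun (cot_rco t)).
  elim/tens_ind: (cot_rco t) => [h s|s s' IHs IHs']; last by rewrite !linearD /= IHs IHs'.
  by rewrite tmapE !tevalrE linearZ.
rewrite cot_rcoE; elim/tens_ind: (vsval t) => [x y|s s' IHs IHs']; last by rewrite !linearD /= IHs IHs'.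
rewrite cot_rLambdaE -{2}(rco1 y).
elim/tens_ind: (rco B y) => [y' k|s s' IHs IHs']; last by rewrite tpureDr tassocVD !linearD /= IHs IHs' tpureDr.
by rewrite tassocVE !tevalrE tpureZr.
Qed.

Lemma cot_lcoA t : tassoc (tmap (comul H) idfun (cot_lco t)) = tmap idfun cot_lco (cot_lco t).
Proof. exact: (@cot_coactA K H A (lcomod B)). Qed.
Lemma cot_lco1 t : tevall (counit H) (cot_lco t) = t.
Proof. exact: (@cot_coact1 K H A (lcomod B)). Qed.

Lemma cot_lrco t : tassoc (tmap cot_lco idfun (cot_rco t)) = tmap idfun cot_rco (cot_lco t).
Proof.
pose La : {linear tens A B -> tens H (tens A B)} := @tassoc K H A B \o tmap (lco A) idfun.
apply: (tmap_injr (f := tmap vsval idfun) (g := tmap (vsproj cot_aspace) idfun)).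
  by move=> s; rewrite /= tmap_comp -[RHS]tmap_id; apply: eq_tmap => // u; apply: vsvalK.
have -> : tmap idfun (tmap vsval idfun) (tassoc (tmap cot_lco idfun (cot_rco t))) =
    tassoc (tmap La idfun (cot_rLambda (vsval t))).
  rewrite -cot_rcoE -tassoc_nat; congr tassoc; rewrite !tmap_comp.
  by apply: eq_tmap => // u; apply: cot_lcoE.
have -> : tmap idfun (tmap vsval idfun) (tmap idfun cot_rco (cot_lco t)) =
    tmap idfun (@cot_rLambda) (La (vsval t)).
  rewrite -[La _]cot_lcoE !tmap_comp; apply: eq_tmap => // u; apply: cot_rcoE.
elim/tens_ind: (vsval t) => [x y|s s' IHs IHs']; last by rewrite cot_rLambdaD linearD /= !tensD IHs IHs'.
rewrite cot_rLambdaE /La /= tmapE /=.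
transitivity (tmap idfun (@tassocV K A B H) (tassoc (lco A x *t rco B y))).
  elim/tens_ind: (rco B y) => [y' k|s s' IHs IHs']; last by rewrite !tensD IHs IHs'.
  rewrite tassocVE tmapE /= tmapE /=.
  elim/tens_ind: (lco A x) => [h x'|s s' IHs IHs']; last by rewrite !tensD IHs IHs'.
  by rewrite !tassocE tmapE /= tassocVE.
elim/tens_ind: (lco A x) => [h x'|s s' IHs IHs']; last by rewrite !tensD IHs IHs'.
by rewrite !tassocE !tmapE /= cot_rLambdaE.
Qed.

Definition cotalg : bicomodAlg H := BicomodAlg cot_lcoA cot_lco1 cot_rcoA cot_rco1 cot_lrco.
End CotensorAlg.

(* L [] k_g is isomorphic to k_h for exactly one group-like h. *)
Definition phi (K : fieldType) (H : hopfAlg K) (L : bicomodAlg H)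
    (g : grouplikes H) : grouplikes H :=
  xget (grouplike1 H)
    [set h | exists f : {linear kg h -> cot L (kg g)}, comod_iso f]%classic.

Section CotensorMaps.
Variables (K : fieldType) (H : hopfAlg K).
Implicit Types (A B : bicomodAlg H) (X Y : comod H).

(* The map f (x) h, from A [] X to A' [] X'; it is only used when f (x) h sends
   the first cotensor product into the second one, and then the projection
   vsproj is the identity on the values. *)
Definition cotmap A A' X X' (f : A -> A') (h : X -> X') (t : cot A X) : cot A' X' :=
  vsproj _ (tmap f h (vsval t)).

(* A [] (B [] X) = (A [] B) [] X *)
Definition cotassocV A B X (t : cot A (cot B X)) : cot (cotalg A B) X :=
  vsproj _ (tmap (vsproj _) idfun (tassocV (tmap idfun vsval (vsval t)))).

(* (A [] X) (x) (A [] Y) -> A [] (X (x) Y) *)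
Definition cotmul A X Y (s : cot A X) (t : cot A Y) : cot A (comod_tens X Y) :=
  vsproj _ (tmul2 *%R (@tpure K X Y) (vsval s) (vsval t)).

Definition linv (U V : vectType K) (f : {linear U -> V}) : V -> U :=
  ((linfun f)^-1)%VF.
End CotensorMaps.
HB.instance Definition _ (K : fieldType) (H : hopfAlg K) (A A' : bicomodAlg H)
    (X X' : comod H) (f : A -> A') (h : X -> X') :=
  GRing.Linear.copy (@cotmap K H A A' X X' f h) (vsproj _ \o tmap f h \o vsval).
HB.instance Definition _ (K : fieldType) (H : hopfAlg K) (A B : bicomodAlg H)
    (X : comod H) :=
  GRing.Linear.copy (@cotassocV K H A B X)
    (vsproj _ \o tmap (vsproj _) idfun \o @tassocV K _ _ _ \o tmap idfun vsval \o vsval).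

Section CrossedDatum.
Variables (K : fieldType) (H : hopfAlg K) (Gamma : finGroupType).

Definition bccast (A B : bicomodAlg H) (e : A = B) : {linear A -> B} :=
  match e in _ = C return {linear A -> C} with erefl => idfun end.

(* identity of L a if a = b (in particular L ((a * b) * c) = L (a * (b * c))), else 0 *)
Definition degmap (L : Gamma -> bicomodAlg H) (a b : Gamma) : {linear L a -> L b} :=
  match @eqP _ a b with
  | ReflectT e => bccast (congr1 L e)
  | ReflectF _ => \0
  end.

Record normalized_cocycle3 (gamma : Gamma -> Gamma -> Gamma -> K) : Prop :=
  NormalizedCocycle3 {
  coc3_neq0 : forall a b c, gamma a b c != 0;
  coc3_eq : forall a b c d,
    gamma b c d * gamma a (b * c)%g d * gamma a b c =
    gamma (a * b)%g c d * gamma a b (c * d)%g;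
  coc3_1 : forall a b, [/\ gamma 1%g a b = 1, gamma a 1%g b = 1 & gamma a b 1%g = 1] }.

(* cd_f2 is f^{ab,c} (f^{a,b} (x) id) = f^{a,bc} (id (x) f^{b,c}).  As f^{b,c} is
   left colinear for the coaction twisted by g(b,c), id (x) f^{b,c} sends
   L_a [] (L_b [] L_c)^{g(b,c)}, and not L_a [] L_b [] L_c, into L_a [] L_{bc}.
   These two sources are identified by x (x) t |-> u^{-1} x u (x) t, where u spans
   the line L_a [] k_{g(b,c)}, that is, rho(u) = u (x) g(b,c); this does not depend
   on the choice of u.  The identification comes from moving L_a [] k_{g(b,c)}
   through L_a [] L_b [] Z in the associativity constraint below. *)
Record crossedDatum := CrossedDatum {
  cd_L : Gamma -> bicomodAlg H;
  cd_biGalois : forall a, biGalois (cd_L a);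
  cd_g : Gamma -> Gamma -> grouplikes H;
  cd_f : forall a b,
    {lrmorphism twist (cotalg (cd_L a) (cd_L b)) (cd_g a b) -> cd_L (a * b)%g};
  cd_f_iso : forall a b, bicomodAlg_iso (cd_f a b);
  cd_gamma : Gamma -> Gamma -> Gamma -> K;
  cd_gamma_coc : normalized_cocycle3 cd_gamma;
  cd_L1 : cd_L 1%g = regbc H;
  cd_g1 : forall a, cd_g 1%g a = grouplike1 H /\ cd_g a 1%g = grouplike1 H;
  cd_f1l : forall a (t : cotalg (cd_L 1%g) (cd_L a)),
    degmap cd_L (1 * a)%g a (cd_f 1%g a t) =
    tevall (counit H) (tmap (bccast cd_L1) idfun (vsval t));
  cd_f1r : forall a (t : cotalg (cd_L a) (cd_L 1%g)),
    degmap cd_L (a * 1)%g a (cd_f a 1%g t) =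
    tevalr (counit H) (tmap idfun (bccast cd_L1) (vsval t));
  cd_g2 : forall a b c,
    val (phi (cd_L a) (cd_g b c)) * val (cd_g a (b * c)%g) =
    val (cd_g a b) * val (cd_g (a * b)%g c);
  cd_f2 : forall a b c (u : cd_L a), u != 0 -> rco (cd_L a) u = u *t val (cd_g b c) ->
    forall t : cot (cd_L a) (cot (cd_L b) (lcomod (cd_L c))),
    degmap cd_L (a * b * c)%g (a * (b * c))%g
      (cd_f (a * b)%g c
        (@cotmap K H (cotalg (cd_L a) (cd_L b)) (cd_L (a * b)%g)
           (lcomod (cd_L c)) (lcomod (cd_L c)) (cd_f a b) idfun (cotassocV t))) =
    cd_f a (b * c)%g
      (@cotmap K H (cd_L a) (cd_L a) (cot (cd_L b) (lcomod (cd_L c)))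
         (lcomod (cd_L (b * c)%g)) (fun x => u^-1 * x * u) (cd_f b c) t) }.

Variable U : crossedDatum.
Notation L := (cd_L U).
Notation g := (cd_g U).

(* Comod(H)(U).  The pair (X, a) is [X, a], the comodule X placed in degree a;
   there are only zero morphisms between objects of distinct degrees.  Every
   object of the direct sum is a finite direct sum of such homogeneous objects,
   and the tensor product, the associativity constraint and the braidings are
   additive in each argument, so they are given on the homogeneous objects. *)
Definition gobj : Type := (comod H * Gamma)%type.

Definition ghom (X Y : gobj) (f : X.1 -> Y.1) : Prop :=
  colinear f /\ (X.2 != Y.2 -> forall x, f x = 0).

Definition gtens (X Y : gobj) : gobj :=
  (comod_tens X.1 (comod_tens (cot (L X.2) Y.1) (kg (g X.2 Y.2))), (X.2 * Y.2)%g).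

(* The tensor product of morphisms; it is zero when f or h joins distinct degrees. *)
Definition gtens_map (X X' Y Y' : gobj) (f : X.1 -> X'.1) (h : Y.1 -> Y'.1) :
    (gtens X Y).1 -> (gtens X' Y').1 :=
  tmap f (tmap (cotmap (degmap L X.2 X'.2) h) idfun).

(* The isomorphisms k_{phi(L_a, g(b,c))} -> L_a [] k_{g(b,c)} used in the
   associativity constraint; they are unique up to nonzero scalars. *)
Record identifications := Identifications {
  idt :> forall a b c, {linear kg (phi (L a) (g b c)) -> cot (L a) (kg (g b c))};
  idt_iso : forall a b c, comod_iso (idt a b c) }.

Variable theta : identifications.

(* f^{a,b} (x) id_Z, from L_a [] L_b [] Z to L_{ab} [] Z *)
Definition fid (a b : Gamma) (Z : comod H) : cot (L a) (cot (L b) Z) -> cot (L (a * b)%g) Z :=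
  @cotmap K H (cotalg (L a) (L b)) (L (a * b)%g) Z Z (cd_f U a b) idfun \o @cotassocV K H (L a) (L b) Z.
HB.instance Definition _ a b Z := GRing.Linear.on (@fid a b Z).

(* (x (x) (y (x) k)) (x) (s (x) l) is sent to
   gamma(a,b,c) x (x) (y t u (x) k l), where t in L_a [] L_b [] Z is the preimage of s
   by f^{a,b} (x) id_Z, and u in L_a [] k_{g(b,c)} is the image of 1 by theta; the
   product y t u in L_a [] (Y (x) ((L_b [] Z) (x) k_{g(b,c)})) is given by the
   multiplication of L_a. *)
Definition gassoc (X Y Z : gobj) :
    (gtens (gtens X Y) Z).1 -> (gtens X (gtens Y Z)).1 :=
  tlift (fun p : (gtens X Y).1 => tlift (fun s (l : K^o) =>
    tlift (fun x : X.1 => tlift (fun (y : cot (L X.2) Y.1) (k : K^o) =>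
      (cd_gamma U X.2 Y.2 Z.2 * (k * l)) *:
        (x *t (cotmul y (cotmul (linv (@fid X.2 Y.2 Z.1) s)
                                (theta X.2 Y.2 Z.2 1)) *t (1 : K^o))))) p)).
Arguments gassoc : clear implicits.
HB.instance Definition _ X Y Z := GRing.Linear.copy (gassoc X Y Z) (tlift _).

(* A natural isomorphism [X,a] (x) [Y,b] -> [Y,b] (x) [X,a] satisfying the two
   hexagon axioms. *)
Record braiding := Braiding {
  br :> forall X Y : gobj, {linear (gtens X Y).1 -> (gtens Y X).1};
  br_hom : forall X Y, ghom (br X Y);
  br_bij : forall X Y, bijective (br X Y);
  br_nat : forall (X X' Y Y' : gobj) (f : {linear X.1 -> X'.1}) (h : {linear Y.1 -> Y'.1}),
    ghom f -> ghom h -> forall t,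
    br X' Y' (gtens_map f h t) = gtens_map h f (br X Y t);
  br_hex1 : forall (X Y Z : gobj) t,
    gassoc Y Z X (br X (gtens Y Z) (gassoc X Y Z t)) =
    @gtens_map Y Y (gtens X Z) (gtens Z X) idfun (br X Z)
      (gassoc Y X Z (@gtens_map (gtens X Y) (gtens Y X) Z Z (br X Y) idfun t));
  br_hex2 : forall (X Y Z : gobj) t,
    linv (gassoc Z X Y) (br (gtens X Y) Z (linv (gassoc X Y Z) t)) =
    @gtens_map (gtens X Z) (gtens Z X) Y Y (br X Z) idfun
      (linv (gassoc X Z Y) (@gtens_map X X (gtens Y Z) (gtens Z Y) idfun (br Y Z) t)) }.

(* The data (g, f, gamma) of a crossed datum in which every L_a is H *)
Record Hdatum (g : Gamma -> Gamma -> grouplikes H)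
    (f : forall a b, {lrmorphism twist (regbc H) (g a b) -> regbc H})
    (gamma : Gamma -> Gamma -> Gamma -> K) : Prop := HDatum {
  hd_g2 : forall a b c,
    val (g b c) * val (g a (b * c)%g) = val (g a b) * val (g (a * b)%g c);
  hd_g1 : forall a, g 1%g a = grouplike1 H /\ g a 1%g = grouplike1 H;
  hd_f_iso : forall a b, bicomodAlg_iso (f a b);
  hd_f2 : forall a b c (h : H), f (a * b)%g c (f a b h) = f a (b * c)%g (f b c h);
  hd_gamma : normalized_cocycle3 gamma }.

(* (g', f, gamma) is the crossed datum obtained from U by transporting all its
   structure along the isomorphisms psi_a : L_a -> H; the map (counit (x) id) is
   the canonical isomorphism from H [] H to H. *)
Record transported (g' : Gamma -> Gamma -> grouplikes H)
    (f : forall a b, {lrmorphism twist (regbc H) (g' a b) -> regbc H})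
    (gamma : Gamma -> Gamma -> Gamma -> K)
    (psi : forall a, {lrmorphism L a -> regbc H}) : Prop := Transported {
  tr_g : forall a b, g a b = g' a b;
  tr_gamma : forall a b c, cd_gamma U a b c = gamma a b c;
  tr_iso : forall a, bicomodAlg_iso (psi a);
  tr_psi1 : psi 1%g =1 bccast (cd_L1 U);
  tr_f : forall a b (t : cotalg (L a) (L b)),
    psi (a * b)%g (cd_f U a b t) =
    f a b (tevall (counit H) (tmap (psi a) (psi b) (vsval t))) }.

Definition comes_from (g' : Gamma -> Gamma -> grouplikes H)
    (f : forall a b, {lrmorphism twist (regbc H) (g' a b) -> regbc H})
    (gamma : Gamma -> Gamma -> Gamma -> K) : Prop :=
  exists psi : (forall a, {lrmorphism L a -> regbc H}), transported f gamma psi.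

End CrossedDatum.

(* Main.v *)
(* Given a braiding c, its component at ([k, a], [X, 1]) is, after
   identifying L_1 [] k with k by the counit of L_1 = H, an isomorphism
   N_X : L_a [] X -> X of comodules, natural in X.  The group-like factors and the
   cocycle gamma are trivial here because one index is always 1, and the chosen
   identifications of L_a [] k_1 are scalars because L_a is right Galois.  The
   first hexagon axiom at ([k, a], [X, 1], [Y, 1]) then says, once every factor
   L_1 has been evaluated by the counit, that N is multiplicative up to a nonzero
   scalar.  Taking X = Y = H, the map N_H o rho : L_a -> H is left colinear, right
   colinear (by naturality along h |-> h_1 p(h_2)) and multiplicative up to a
   scalar; rescaling it gives L_a = H.  The group Gamma is abelian because
   [k, a] (x) [k, b] is nonzero of degree ab and isomorphic to an object of degree
   ba.  Finally the crossed datum is transported along these isomorphisms; in the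
   compatibility of the f^{a,b} one takes for u the preimage of the group-like
   g(b,c), so that conjugation by u is the twist of the left coaction. *)
Require Import Defs.
From HB Require Import structures.
From mathcomp Require Import all_boot all_fingroup all_algebra falgebra.
From mathcomp Require boolp classical_sets.
Set Implicit Arguments.
Unset Strict Implicit.
Unset Printing Implicit Defensive.
Import GRing.Theory VectorInternalTheory.
Local Open Scope ring_scope.

(** * Complements on tensor and cotensor products *)

Section Tens.
Variable K : fieldType.

(** The coordinate functionals of [V] read off the matrix entries of a tensor. This allows right
    colinearity to be tested one functional at a time. *)
Lemma eq_tevalr (U V : vectType K) (s t : tens U V) :
  (forall p : {linear V -> K^o}, tevalr p s = tevalr p t) -> s = t.
Proof.
move=> e; apply/matrixP => i j.
pose p (v : V) : K^o := v2r v 0 j.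
have plin : linear p by move=> a u v; rewrite /p linearP !mxE.
pose P : {linear V -> K^o} := HB.pack p (GRing.isLinear.Build _ _ _ _ _ plin).
suff E (r : tens U V) : v2r (tevalr P r) 0 i = (r : 'M_(_, _)) i j.
  by rewrite -!E e.
elim/tens_ind: r => [u v|r r' IHr IHr'].
  by rewrite tevalrE linearZ /= /p /tpure !mxE big_ord1 !mxE mulrC.
by rewrite !linearD !mxE IHr IHr'.
Qed.

(** The left-hand side is the nest of four [tlift] of the associativity constraint; multilinearity
    of [G] lets them be evaluated one after another. *)
Lemma tlift_scalarsE (X Y S W : vectType K) (G : X -> Y -> S -> W) (c : K) x y k s l :
  (forall y s, linear (fun x => G x y s)) -> (forall x s, linear (fun y => G x y s)) ->
  (forall x y, linear (G x y)) ->
  tlift (fun p : tens X (tens Y K^o) => tlift (fun (s : S) (l : K^o) =>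
    tlift (fun x : X => tlift (fun (y : Y) (k : K^o) => (c * (k * l)) *: G x y s)) p))
    ((x *t (y *t k)) *t (s *t l)) = (c * (k * l)) *: G x y s.
Proof.
move=> Gx Gy Gs.
have mulKD (b u v m : K) : m * (b * u + v) = b * (m * u) + m * v.
  by rewrite mulrDr mulrCA.
have Zl b u v z w : (c * (z * (b * u + v : K^o))) *: G w.1.1 w.1.2 w.2 =
    b *: ((c * (z * u)) *: G w.1.1 w.1.2 w.2) + (c * (z * v)) *: G w.1.1 w.1.2 w.2.
  by rewrite !mulKD scalerDl scalerA.
rewrite tliftE; last first.
  split=> [z|z]; first by apply: linear_tlift => ? ? b u v; rewrite linearP.
  by move=> b u v; rewrite linearP.
rewrite tliftE; last first.
  split=> z; apply: linear_tlift => x' yk; apply: linear_tlift => y' k' b u v /=.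
    by rewrite Gs scalerDr !scalerA mulrC.
  exact: (Zl _ _ _ _ ((x', y'), z)).
rewrite tliftE; last first.
  split=> z; last by move=> b u v; rewrite linearP.
  by apply: linear_tlift => y' k' b u v /=; rewrite Gx scalerDr !scalerA mulrC.
rewrite tliftE //; split=> z b u v /=; first by rewrite Gy scalerDr !scalerA mulrC.
by rewrite ![_ * l]mulrC; exact: (Zl _ _ _ _ ((x, z), s)).
Qed.

End Tens.

Section Cot.
Variables (K : fieldType) (H : hopfAlg K).
Implicit Types (A B : bicomodAlg H) (X Y : comod H).

Definition rcolinear A B (f : A -> B) := forall x, rco B (f x) = tmap f idfun (rco A x).

Lemma cotP A X (t : cot A X) :
  tassoc (tmap (rco A) idfun (vsval t)) = tmap idfun coact (vsval t).
Proof. exact/mem_cot/subvsP. Qed.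

(** Colinearity of [f] and [h] makes [tmap f h] preserve the equation of the cotensor product, so
    the projection in [cotmap] does nothing. *)
Lemma cotmapE A B X Y (f : {linear A -> B}) (h : {linear X -> Y}) (t : cot A X) :
  rcolinear f -> colinear h -> vsval (cotmap f h t : cot B Y) = tmap f h (vsval t).
Proof.
move=> fr hl; rewrite /cotmap vsprojK //; apply/mem_cot.
have -> : tmap (rco B) idfun (tmap f h (vsval t)) =
    tmap (tmap f idfun) h (tmap (rco A) idfun (vsval t)).
  by rewrite !tmap_comp; apply: eq_tmap => // x /=; rewrite fr.
rewrite tassoc_nat cotP !tmap_comp; apply: eq_tmap => // x /=.
by rewrite hl.
Qed.

(** The coactions of A and of X (x) Y are multiplicative, so the cotensor equation for the product
    is the legwise product of those for [s] and [t]. *)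
Lemma cotmulE A X Y (s : cot A X) (t : cot A Y) :
  vsval (cotmul s t) = tmul2 *%R (@tpure K X Y) (vsval s) (vsval t).
Proof.
rewrite /cotmul vsprojK //; apply/mem_cot.
have bm := bilin_mul H; have bp := bilin_tpure X Y; have bA := bilin_mul A.
have bmp : bilin (tmul2 ( *%R : H -> H -> H) (@tpure K X Y)) by apply: bilin_tmul2.
pose M := tmul2 ( *%R : A -> A -> A) (tmul2 ( *%R : H -> H -> H) (@tpure K X Y)).
transitivity (M (tassoc (tmap (rco A) idfun (vsval s))) (tassoc (tmap (rco A) idfun (vsval t)))).
  elim/tens_ind: (vsval s) => [a x|u v IHu IHv]; last by rewrite /M !tensD IHu IHv.
  elim/tens_ind: (vsval t) => [b y|u v IHu IHv]; last by rewrite /M !tensD IHu IHv.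
  rewrite tmul2E // !tmapE /= rmorphM /=.
  elim/tens_ind: (rco A a) => [a1 a2|u v IHu IHv]; last by rewrite /M mulrDl !tensD IHu IHv.
  elim/tens_ind: (rco A b) => [b1 b2|u v IHu IHv]; last by rewrite /M mulrDr !tensD IHu IHv.
  by rewrite tpureM !tassocE /M !tmul2E.
rewrite !cotP.
elim/tens_ind: (vsval s) => [a x|u v IHu IHv]; last by rewrite /M !tensD -IHu -IHv.
elim/tens_ind: (vsval t) => [b y|u v IHu IHv]; last by rewrite /M !tensD -IHu -IHv.
rewrite tmul2E // !tmapE /M !tmul2E //=.
by rewrite comod_tens_coactE.
Qed.

(** The projection onto A [] B is harmless: B [] X coacts through its leg B, so the equation for [t]
    is exactly the balancing between A and B. *)
Lemma cotassocV_inner A B X (t : cot A (cot B X)) :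
  let w := tassocV (tmap idfun vsval (vsval t)) in
  tmap vsval idfun (tmap (vsproj (cot_aspace A B)) idfun w) = w.
Proof.
move=> w; apply: (tens_kerl (D := @cot_diff K H A (lcomod B))).
  by move=> u /eqP u0; apply/mem_cota/eqP; rewrite -subr_eq0.
pose D1 : {linear tens A B -> tens A (tens H B)} := @tassoc K A H B \o tmap (rco A) idfun.
pose D2 : {linear tens A B -> tens A (tens H B)} := tmap (idfun : A -> A) (lco B).
have subE (s : tens (tens A B) X) : tmap (@cot_diff K H A (lcomod B)) idfun s =
    tmap D1 idfun s - tmap D2 idfun s.
  elim/tens_ind: s => [p h|s s' IHs IHs']; last by rewrite !tmapD IHs IHs' opprD addrACA.
  rewrite !tmapE /=.
  have -> : cot_diff (p : tens A (lcomod B)) = D1 p - D2 p by [].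
  by rewrite tpureDl -scaleN1r tpureZl scaleN1r.
rewrite subE; apply/eqP; rewrite subr_eq0; apply/eqP.
(* [Phi] regroups A, H, B, X so that the equation for [t] becomes the one for the first two legs. *)
pose Phi (v : tens A (tens H (tens B X))) : tens (tens A (tens H B)) X :=
  tassocV (tmap idfun (@tassocV K H B X) v).
pose t' := tmap idfun vsval (vsval t).
transitivity (Phi (tassoc (tmap (rco A) idfun t'))).
  rewrite /w -/t'; elim/tens_ind: t' => [a q|u v IHu IHv]; last by rewrite /Phi !tensD IHu IHv.
  elim/tens_ind: q => [b x|u v IHu IHv]; last by rewrite /Phi !tensD IHu IHv.
  rewrite tassocVE !tmapE /= tmapE /=.
  elim/tens_ind: (rco A a) => [a' h|u v IHu IHv]; last by rewrite /Phi !tensD IHu IHv.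
  by rewrite /Phi !tassocE !tmapE /= tassocVE tassocVE.
have -> : tassoc (tmap (rco A) idfun t') =
    tmap idfun (@tassoc K H B X) (tmap idfun (tmap (lco B) idfun) t').
  transitivity (tmap idfun (tmap idfun vsval) (tassoc (tmap (rco A) idfun (vsval t)))).
    rewrite -tassoc_nat; congr tassoc; rewrite /t' !tmap_comp.
    by apply: eq_tmap => // x; rewrite /= tmap_id.
  rewrite cotP /t' !tmap_comp; apply: eq_tmap => // x.
  exact: cot_coactE.
rewrite /Phi /w -/t'.
elim/tens_ind: t' => [a q|u v IHu IHv]; last by rewrite !tensD IHu IHv.
elim/tens_ind: q => [b x|u v IHu IHv]; last by rewrite !tensD IHu IHv.
by rewrite tassocVE !tmapE /= tassocK tmapE /= tassocVE tmapE.
Qed.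

(** For the outer projection the equation is the balancing between B and X, since A [] B coacts on
    the right through B; it holds because the second leg of [t] lies in B [] X. *)
Lemma cotassocVE A B X (t : cot A (cot B X)) :
  tmap vsval idfun (vsval (cotassocV t)) = tassocV (tmap idfun vsval (vsval t)).
Proof.
rewrite -[RHS]cotassocV_inner /cotassocV vsprojK //.
apply/mem_cot.
apply: (tmap_injl (f := vsval) (g := vsproj (cot_aspace A B))); first exact: vsvalK.
set w' := tmap _ _ (tassocV _); set w := tassocV (tmap idfun vsval (vsval t)).
have e : tmap vsval idfun w' = w by exact: cotassocV_inner.
transitivity (tassoc (tmap (@cot_rLambda K H A B) idfun w)).
  rewrite -e.
  transitivity (tmap vsval (tmap idfun idfun) (tassoc (tmap (rco (cotalg A B)) idfun w'))).
    by apply: eq_tmap => // u; rewrite tmap_id.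
  rewrite -tassoc_nat; congr tassoc; rewrite !tmap_comp; apply: eq_tmap => // u.
  exact: cot_rcoE.
transitivity (tmap idfun coact w); last by rewrite -e !tmap_comp; apply: eq_tmap.
pose D1 : {linear tens B X -> tens B (tens H X)} := @tassoc K B H X \o tmap (rco B) idfun.
transitivity (tassocV (tmap idfun D1 (tmap idfun vsval (vsval t)))).
  rewrite /w; elim/tens_ind: (tmap idfun vsval (vsval t)) => [a q|u v IHu IHv];
    last by rewrite !tensD IHu IHv.
  rewrite tmapE /D1 /=.
  elim/tens_ind: q => [b x|u v IHu IHv]; last by rewrite !tensD IHu IHv.
  rewrite tassocVE !tmapE /= cot_rLambdaE.
  elim/tens_ind: (rco B b) => [b' h|u v IHu IHv]; last by rewrite !tensD IHu IHv.
  by rewrite tassocVE !tassocE tassocVE.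
transitivity (tassocV (tmap idfun (tmap idfun coact) (tmap idfun vsval (vsval t)))).
  by congr tassocV; rewrite !tmap_comp; apply: eq_tmap => // q; apply: cotP.
rewrite /w; elim/tens_ind: (tmap idfun vsval (vsval t)) => [a q|u v IHu IHv];
  last by rewrite !tensD IHu IHv.
rewrite tmapE /=.
elim/tens_ind: q => [b x|u v IHu IHv]; last by rewrite !tensD IHu IHv.
rewrite tassocVE !tmapE /=.
elim/tens_ind: (coact x) => [b' h|u v IHu IHv]; last by rewrite !tensD IHu IHv.
by rewrite tassocVE.
Qed.
End Cot.

(** * Evaluating a factor equal to H by the counit *)

Section Unit.
Variables (K : fieldType) (H : hopfAlg K).
Implicit Types (A B : bicomodAlg H) (X Y : comod H).

(** L_1 equals H only through a proof [e], so the counit is composed with a cast. *)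
Definition counit_cast A (e : A = regbc H) : A -> K^o := counit H \o bccast e.
HB.instance Definition _ A (e : A = regbc H) :=
  GRing.Linear.copy (counit_cast e) (counit H \o bccast e).

Lemma counit_cast1 A (e : A = regbc H) : counit_cast e 1 = 1.
Proof. by rewrite /counit_cast; subst A; exact: (rmorph1 (counit H)). Qed.

Lemma counit_castM A (e : A = regbc H) x y :
  counit_cast e (x * y) = counit_cast e x * counit_cast e y.
Proof. by rewrite /counit_cast; subst A; exact: (rmorphM (counit H)). Qed.

(** The canonical isomorphism from H [] Y to Y. *)
Definition cot_counit A (e : A = regbc H) Y (t : cot A Y) : Y := tevall (counit_cast e) (vsval t).
HB.instance Definition _ A (e : A = regbc H) Y :=
  GRing.Linear.copy (@cot_counit A e Y) (tevall (counit_cast e) \o vsval).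

Arguments cot_counit {A} e {Y} t.

(** The counit applied to the first leg of the cotensor equation leaves the coaction on one side
    and, by the counit axiom, [t] on the other. Hence the coaction inverts [cot_counit]. *)
Lemma coact_cot_counit Y (t : cot (regbc H) Y) :
  coact (cot_counit (erefl (regbc H)) t) = vsval t.
Proof.
have et := cotP t.
transitivity (tevall (counit_cast (erefl (regbc H))) (tmap idfun coact (vsval t))).
  rewrite /cot_counit; elim/tens_ind: (vsval t) => [h y|u v IHu IHv];
    last by rewrite !linearD /= IHu IHv.
  by rewrite tmapE !tevallE linearZ.
rewrite -et.
elim/tens_ind: (vsval t) => [h y|u v IHu IHv]; last by rewrite !linearD /= IHu IHv.
rewrite tmapE /=; transitivity (tevall (counit H) (comul H h) *t y).
  elim/tens_ind: (comul H h) => [a b|u v IHu IHv];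
    last by rewrite tpureDl !linearD /= IHu IHv tpureDl.
  by rewrite tassocE !tevallE tpureZl.
by rewrite counitl.
Qed.

Lemma colinear_cot_counit A (e : A = regbc H) Y : colinear (cot_counit e : cot A Y -> Y).
Proof.
subst A => t; rewrite coact_cot_counit.
transitivity (tmap idfun (tevall (counit_cast (erefl (regbc H)))) (tmap idfun vsval (coact t))); last first.
  by rewrite tmap_comp; apply: eq_tmap.
rewrite [tmap _ vsval _]cot_coactE /cot_Lambda.
elim/tens_ind: (vsval t) => [h y|u v IHu IHv]; last by rewrite !linearD /= -IHu -IHv.
rewrite tmapE /=; transitivity (tevalr (counit H) (comul H h) *t y).
  by rewrite counitr.
elim/tens_ind: (comul H h) => [a b|u v IHu IHv];
  last by rewrite tpureDl !linearD /= -IHu -IHv tpureDl.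
by rewrite tassocE tmapE /= tevallE tevalrE tpureZl tpureZr.
Qed.

Lemma cot_counit_inj A (e : A = regbc H) Y : injective (cot_counit e : cot A Y -> Y).
Proof.
by subst A => s t est; apply/subvs_inj; rewrite -!coact_cot_counit est.
Qed.

(** The section is the coaction, with values in H [] Y by coassociativity. It is given by existence
    because it is available only once [e] has been eliminated. *)
Lemma cot_counit_sect A (e : A = regbc H) Y :
  exists j : {linear Y -> cot A Y}, colinear j /\ forall y, cot_counit e (j y) = y.
Proof.
subst A.
exists (vsproj (cot_space (regbc H) Y) \o coact).
have jE y : cot_counit (erefl (regbc H)) (vsproj (cot_space (regbc H) Y) (coact y)) = y.
  rewrite /cot_counit vsprojK; first exact: coact1.
  by apply/mem_cot; exact: coactA.
split=> // y; apply: (tmap_injr (f := cot_counit (erefl (regbc H))) (g := vsproj _ \o coact)).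
  by move=> t; apply: (@cot_counit_inj _ (erefl _)); rewrite /= jE.
transitivity (coact y).
  by rewrite -(colinear_cot_counit (erefl (regbc H))) /= jE.
by rewrite tmap_comp -[LHS]tmap_id; apply: eq_tmap => // z; rewrite /= jE.
Qed.

End Unit.
Arguments cot_counit {K H A} e {Y} t.

(** * Casts between the L_a along equalities of degrees *)

Section Degmap.
Variables (K : fieldType) (H : hopfAlg K) (Gamma : finGroupType).
Variable L : Gamma -> bicomodAlg H.

(** Equality in the group is decidable, so all proofs of [a = b] agree. *)
Lemma degmapE a b (e : a = b) x : degmap L a b x = bccast (congr1 L e) x.
Proof.
rewrite /degmap; case: eqP => [e'|//].
by rewrite (eq_irrelevance e e').
Qed.

Lemma degmap_id a x : degmap L a a x = x.
Proof. by rewrite (degmapE erefl). Qed.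

Lemma degmap_comp a b c (e : a = b) (e' : b = c) x :
  degmap L b c (degmap L a b x) = degmap L a c x.
Proof. by subst; rewrite !degmap_id. Qed.

Lemma degmapK a b (e : a = b) : cancel (degmap L a b) (degmap L b a).
Proof. by subst=> x; rewrite !degmap_id. Qed.

Lemma degmap_rcolinear a b (e : a = b) : rcolinear (degmap L a b).
Proof.
subst=> x; rewrite degmap_id -[LHS]tmap_id; apply: eq_tmap => // y.
by rewrite degmap_id.
Qed.
End Degmap.

(** * Functoriality of the cotensor product, and its value on the trivial comodule *)

Section CotMore.
Variables (K : fieldType) (H : hopfAlg K).
Implicit Types (A B C : bicomodAlg H) (X Y Z : comod H).

(** [linv] is a section over the image of [f]. This suffices below, where its arguments are
    exhibited as values of [fid]. *)
Lemma linvK (U V : vectType K) (f : {linear U -> V}) u : f (linv f (f u)) = f u.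
Proof.
have := limg_lfunVK (f := linfun f) (memv_img (linfun f) (memvf u)).
by rewrite !lfunE.
Qed.

Lemma colinear_id X : colinear (idfun : X -> X).
Proof. by move=> x; rewrite tmap_id. Qed.

Lemma rcolinear_id A : rcolinear (idfun : A -> A).
Proof. by move=> x; rewrite tmap_id. Qed.

Lemma cotmap_comp A B C X Y Z (f : {linear A -> B}) (f' : {linear B -> C})
  (h : {linear X -> Y}) (h' : {linear Y -> Z}) (t : cot A X) :
  rcolinear f -> colinear h -> rcolinear f' -> colinear h' ->
  cotmap f' h' (cotmap f h t : cot B Y) = cotmap (f' \o f) (h' \o h) t :> cot C Z.
Proof.
move=> fr hc fr' hc'; apply: subvs_inj.
rewrite !cotmapE // ?tmap_comp //.
- by move=> x /=; rewrite fr' fr tmap_comp.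
- by move=> x /=; rewrite hc' hc tmap_comp.
Qed.

Lemma cotmap_id A X (f : A -> A) (h : X -> X) (t : cot A X) :
  f =1 idfun -> h =1 idfun -> cotmap f h t = t.
Proof.
move=> ef eh; rewrite /cotmap.
rewrite (_ : tmap f h (vsval t) = vsval t) ?vsvalK //.
by rewrite -[RHS]tmap_id; apply: eq_tmap.
Qed.

(** Such an element is x (x) 1 with x right coinvariant, and the coinvariants of a right Galois
    extension are the scalars. *)
Lemma cot_k_scalar A (h : grouplikes H) (s : cot A (kg h)) :
  rightGalois A -> h = grouplike1 H -> exists k : K, vsval s = k *: (1 *t (1 : K^o)).
Proof.
move=> galA h1; subst h.
pose x : A := tevalr (idfun : K^o -> K^o) (vsval s).
have sx : vsval s = x *t (1 : K^o).
  rewrite /x; elim/tens_ind: (vsval s) => [a k|u v IHu IHv].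
    by rewrite tevalrE /= tpureZl -tpureZr [k *: _]mulr1.
  by rewrite linearD tpureDl -IHu -IHv.
have := cotP s; rewrite sx !tmapE /= => e.
have rx : rco A x = x *t 1.
  have /= := congr1 (tmap idfun (tevalr (idfun : K^o -> K^o))) e.
  rewrite -[kg_coact 1 1]/(1 *t (1 : K^o)) tmapE /= tevalrE scale1r => <-.
  elim/tens_ind: (rco A x) => [a k|u v IHu IHv].
    by rewrite tassocE tmapE /= tevalrE scale1r.
  by rewrite tpureDl !linearD /= -IHu -IHv.
have [k ->] := (rgal_coinv galA x).1 rx.
by exists k; rewrite tpureZl.
Qed.

Lemma cotmul_linearr A X Y (s : cot A X) : linear (@cotmul K H A X Y s).
Proof. by move=> a t t'; rewrite /cotmul !linearP. Qed.

Lemma cotmul_linearl A X Y (t : cot A Y) : linear (fun s : cot A X => cotmul s t).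
Proof.
move=> a s s'; rewrite /cotmul linearP /=.
by rewrite tmul2Dl tmul2Zl linearP.
Qed.

End CotMore.

(** * The associativity constraint of Comod(H)(U) *)

Section Crossed.
Variables (K : fieldType) (H : hopfAlg K) (Gamma : finGroupType).
Variable U : crossedDatum H Gamma.
Notation L := (cd_L U).
Notation g := (cd_g U).
Notation e1 := (cd_L1 U).

Lemma cd_f_rcolinear a b : rcolinear (cd_f U a b : cotalg (L a) (L b) -> L (a * b)%g).
Proof. exact: bci_rco (cd_f_iso U a b). Qed.

Lemma vsval_fid a b Z t :
  vsval (fid t : cot (L (a * b)%g) Z) =
  tmap (cd_f U a b : cotalg (L a) (L b) -> L (a * b)%g) idfun (vsval (cotassocV t)).
Proof.
rewrite /fid /= cotmapE //; [exact: cd_f_rcolinear | exact: colinear_id].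
Qed.

(** By the unit condition of the crossed datum, f^{1,a} evaluates the leg L_1 by the counit;
    rebracketing turns this into the counit on the first leg of [t]. *)
Lemma fid_cot_counit_l a Z (t : cot (L 1%g) (cot (L a) Z)) :
  cotmap (degmap L (1 * a)%g a) idfun (fid t) = cot_counit e1 t.
Proof.
apply: subvs_inj.
rewrite cotmapE; [|exact/degmap_rcolinear/mul1g|exact: colinear_id].
rewrite vsval_fid tmap_comp.
pose E : {linear tens (L 1%g) (L a) -> L a} := tevall (counit_cast e1).
transitivity (tmap E idfun (tmap vsval idfun (vsval (cotassocV t)))).
  rewrite tmap_comp; apply: eq_tmap => // u /=; rewrite cd_f1l /E /=.
  elim/tens_ind: (vsval u) => [x y|v w IHv IHw]; last by rewrite !linearD /= IHv IHw.
  by rewrite tmapE !tevallE.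
rewrite cotassocVE.
transitivity (tevall (counit_cast e1) (tmap idfun vsval (vsval t))); last first.
  rewrite /cot_counit; elim/tens_ind: (vsval t) => [x y|v w IHv IHw];
    last by rewrite !linearD /= IHv IHw.
  by rewrite tmapE !tevallE linearZ.
elim/tens_ind: (tmap idfun vsval (vsval t)) => [x y|v w IHv IHw];
  last by rewrite !linearD /= IHv IHw.
elim/tens_ind: y => [y z|v w IHv IHw]; last by rewrite !tpureDr !linearD /= IHv IHw.
by rewrite tassocVE tmapE /E /= !tevallE tpureZl.
Qed.

Lemma fid_cot_counit_r a Z (t : cot (L a) (cot (L 1%g) Z)) :
  cotmap (degmap L (a * 1)%g a) idfun (fid t) = cotmap idfun (cot_counit e1) t.
Proof.
apply: subvs_inj.
rewrite cotmapE; [|exact/degmap_rcolinear/mulg1|exact: colinear_id].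
rewrite vsval_fid cotmapE; [|exact: rcolinear_id|exact: colinear_cot_counit].
rewrite tmap_comp.
pose E : {linear tens (L a) (L 1%g) -> L a} := tevalr (counit_cast e1).
transitivity (tmap E idfun (tmap vsval idfun (vsval (cotassocV t)))).
  rewrite tmap_comp; apply: eq_tmap => // u /=; rewrite cd_f1r /E /=.
  elim/tens_ind: (vsval u) => [x y|v w IHv IHw]; last by rewrite !linearD /= IHv IHw.
  by rewrite tmapE !tevalrE.
rewrite cotassocVE.
transitivity (tmap idfun (tevall (counit_cast e1)) (tmap idfun vsval (vsval t))); last first.
  by rewrite tmap_comp; apply: eq_tmap.
elim/tens_ind: (tmap idfun vsval (vsval t)) => [x y|v w IHv IHw];
  last by rewrite !linearD /= IHv IHw.
elim/tens_ind: y => [y z|v w IHv IHw]; last by rewrite !tpureDr !linearD /= IHv IHw.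
by rewrite tassocVE !tmapE /E /= tevallE tevalrE tpureZl tpureZr.
Qed.

Lemma cot_degmapK a b Z (e : a = b) (s : cot (L a) Z) :
  cotmap (degmap L b a) idfun (cotmap (degmap L a b) idfun s : cot (L b) Z) = s.
Proof.
rewrite cotmap_comp; try exact: colinear_id; try by apply: degmap_rcolinear.
by apply: cotmap_id => // x /=; rewrite degmapK.
Qed.

(** The section of [cot_counit] exhibits [s] as a value of [fid], and [fid_cot_counit_l] computes
    the rest. *)
Lemma fid_linv_1l a Z s :
  cot_counit e1 (linv (@fid _ _ _ U 1%g a Z) s) = cotmap (degmap L (1 * a)%g a) idfun s.
Proof.
have [j [_ jK]] := cot_counit_sect e1 (cot (L a) Z).
suff <- : fid (j (cotmap (degmap L (1 * a)%g a) idfun s)) = s.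
  by rewrite -!fid_cot_counit_l linvK.
apply: (can_inj (cot_degmapK (mul1g a))).
by rewrite fid_cot_counit_l jK.
Qed.

Lemma fid_linv_1r a Z s :
  cotmap idfun (cot_counit e1) (linv (@fid _ _ _ U a 1%g Z) s) = cotmap (degmap L (a * 1)%g a) idfun s.
Proof.
have [j [jc jK]] := cot_counit_sect e1 Z.
suff <- : fid (cotmap idfun j (cotmap (degmap L (a * 1)%g a) idfun s)) = s.
  by rewrite -!fid_cot_counit_r linvK.
apply: (can_inj (cot_degmapK (mulg1 a))).
rewrite fid_cot_counit_r cotmap_comp //; try exact: rcolinear_id; try exact: colinear_cot_counit.
by apply: cotmap_id => // x /=; rewrite jK.
Qed.

Variable theta : identifications U.

(** L_a [] k_1 consists of scalars because L_a is right Galois; injectivity of the identification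
    makes the scalar nonzero. *)
Lemma theta_scalar a b c : g b c = grouplike1 H ->
  exists2 k : K, k != 0 & vsval (theta a b c 1) = k *: (1 *t (1 : K^o)).
Proof.
move=> gbc.
have [k ek] := cot_k_scalar (theta a b c 1) (cd_biGalois U a).2 gbc.
exists k => //; apply/eqP => k0.
have [/bij_inj inj _] := idt_iso theta a b c.
have : theta a b c 1 = theta a b c 0.
  by apply: subvs_inj; rewrite ek k0 scale0r !linear0.
by move/inj/eqP; rewrite oner_eq0.
Qed.

Local Arguments gassoc {K H Gamma U} theta X Y Z _.

Lemma gassocE (X Y Z : gobj H Gamma) (x : X.1) (y : cot (L X.2) Y.1) (k : K^o)
  (s : cot (L (X.2 * Y.2)%g) Z.1) (l : K^o) :
  gassoc theta X Y Z ((x *t (y *t k)) *t (s *t l)) =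
  (cd_gamma U X.2 Y.2 Z.2 * (k * l)) *:
     (x *t (cotmul y (cotmul (linv (@fid _ _ _ U X.2 Y.2 Z.1) s)
                                (theta X.2 Y.2 Z.2 1)) *t (1 : K^o))).
Proof.
pose G (x : X.1) (y : cot (L X.2) Y.1) (s : cot (L (X.2 * Y.2)%g) Z.1) :=
  x *t (cotmul y (cotmul (linv (@fid _ _ _ U X.2 Y.2 Z.1) s) (theta X.2 Y.2 Z.2 1)) *t (1 : K^o)).
apply: (tlift_scalarsE (G := G)) => [y' s' b u v|x' s' b u v|x' y' b u v]; rewrite /G.
- by rewrite tpureDl tpureZl.
- by rewrite cotmul_linearl tpureDl tpureZl tpureDr tpureZr.
have -> : linv (@fid _ _ _ U X.2 Y.2 Z.1) (b *: u + v) =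
    b *: linv (@fid _ _ _ U X.2 Y.2 Z.1) u + linv (@fid _ _ _ U X.2 Y.2 Z.1) v.
  exact: linearP.
by rewrite cotmul_linearl cotmul_linearr tpureDl tpureZl tpureDr tpureZr.
Qed.
End Crossed.

(** * Comodule maps removing trivial one-dimensional factors *)

Section MoreColinear.
Variables (K : fieldType) (H : hopfAlg K).
Implicit Types (A B C : bicomodAlg H) (X Y Z : comod H).

Lemma colinear_comp X Y Z (f : {linear X -> Y}) (h : {linear Y -> Z}) :
  colinear f -> colinear h -> colinear (h \o f).
Proof. by move=> fc hc x /=; rewrite hc fc tmap_comp. Qed.

Lemma colinear_tmap X X' Y Y' (f : {linear X -> X'}) (h : {linear Y -> Y'}) :
  colinear f -> colinear h ->
  colinear (tmap f h : comod_tens X Y -> comod_tens X' Y').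
Proof.
move=> fc hc; elim/tens_ind=> [x y|u v IHu IHv]; last by rewrite !linearD /= IHu IHv.
have bm := bilin_mul H.
have bp := bilin_tpure X Y; have bp' := bilin_tpure X' Y'.
rewrite tmapE /= !comod_tens_coactE fc hc.
elim/tens_ind: (coact x) => [a x'|u v IHu IHv]; last by rewrite !tensD IHu IHv.
elim/tens_ind: (coact y) => [b y'|u v IHu IHv]; last by rewrite !tensD IHu IHv.
by rewrite !tmapE !tmul2E // !tmapE /= tmapE.
Qed.

Definition tensk (V : vectType K) : tens V K^o -> V := tevalr (idfun : K^o -> K^o).
HB.instance Definition _ V := GRing.Linear.copy (@tensk V) (tevalr (idfun : K^o -> K^o)).

Lemma tenskE (V : vectType K) (v : V) (k : K^o) : tensk (v *t k) = k *: v.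
Proof. by rewrite /tensk tevalrE. Qed.

Lemma colinear_tensk X (h : grouplikes H) : h = grouplike1 H ->
  colinear (@tensk X : comod_tens X (kg h) -> X).
Proof.
move=> ->; elim/tens_ind=> [x k|u v IHu IHv]; last by rewrite !linearD /= IHu IHv.
rewrite tenskE /= comod_tens_coactE linearZ /=.
have bm := bilin_mul H; have bp := bilin_tpure X K^o.
rewrite -[coact k]/(1 *t k).
elim/tens_ind: (coact x) => [a x'|u v IHu IHv].
  by rewrite tmul2E // tmapE /= tenskE mulr1 tpureZr.
by rewrite scalerDr !tensD IHu IHv.
Qed.

(** The counit is multiplicative, which turns products in L_1 into products of scalars. *)
Lemma cot_counitM A (e : A = regbc H) X Y (s : cot A X) (t : cot A Y) :
  cot_counit e (cotmul s t) = cot_counit e s *t cot_counit e t.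
Proof.
have bA := bilin_mul A; have bp := bilin_tpure X Y.
rewrite /cot_counit cotmulE.
elim/tens_ind: (vsval s) => [a x|u v IHu IHv];
  last by rewrite tmul2Dl !linearD /= IHu IHv tpureDl.
elim/tens_ind: (vsval t) => [b y|u v IHu IHv]; last by rewrite !linearD /= IHu IHv tpureDr.
by rewrite tmul2E // !tevallE /= counit_castM tpureZl tpureZr scalerA.
Qed.

Lemma cot_counit_cotmap A (e : A = regbc H) X Y (f : A -> A) (h : {linear X -> Y}) (t : cot A X) :
  f =1 idfun -> colinear h -> cot_counit e (cotmap f h t : cot A Y) = h (cot_counit e t).
Proof.
move=> /boolp.funext -> hc.
rewrite /cot_counit cotmapE //; last exact: rcolinear_id.
elim/tens_ind: (vsval t) => [b y|u v IHu IHv]; last by rewrite !linearD /= IHu IHv.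
by rewrite tmapE !tevallE linearZ.
Qed.

Definition cot_counit_kg A (e : A = regbc H) Y (h : grouplikes H)
    (t : comod_tens (cot A Y) (kg h)) : Y := cot_counit e (@tensk (cot A Y) t).
HB.instance Definition _ A (e : A = regbc H) Y h :=
  GRing.Linear.copy (@cot_counit_kg A e Y h) (cot_counit e \o @tensk (cot A Y)).

Lemma cot_counit_kgE A (e : A = regbc H) Y h (s : cot A Y) (k : K^o) :
  @cot_counit_kg A e Y h (s *t k) = k *: cot_counit e s.
Proof. by rewrite /cot_counit_kg /= tenskE linearZ. Qed.

Lemma colinear_cot_counit_kg A (e : A = regbc H) Y h :
  h = grouplike1 H -> colinear (@cot_counit_kg A e Y h).
Proof.
move=> h1; apply: (colinear_comp (X := comod_tens _ (kg h)) (Y := cot A Y) (Z := Y)).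
  exact: colinear_tensk.
exact: colinear_cot_counit.
Qed.

(** For A = L_1 the source has the shape of [X,1] (x) [k_h,b]; every factor but X is evaluated. *)
Definition tens_counit A (e : A = regbc H) X (h h' : grouplikes H)
    (t : comod_tens X (comod_tens (cot A (kg h)) (kg h'))) : X :=
  @tensk X (tmap idfun (@cot_counit_kg A e (kg h) h') t).
HB.instance Definition _ A (e : A = regbc H) X h h' :=
  GRing.Linear.copy (@tens_counit A e X h h') (@tensk X \o tmap idfun (@cot_counit_kg A e (kg h) h')).
Arguments tens_counit {A} e {X h h'} t.

Lemma tens_counitE A (e : A = regbc H) X (h h' : grouplikes H) (x : X) (s : cot A (kg h)) (k : K^o) :
  tens_counit e (x *t (s *t k) : comod_tens X (comod_tens (cot A (kg h)) (kg h'))) =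
    (k * (cot_counit e s : K^o)) *: x.
Proof. by rewrite /tens_counit tmapE /= tenskE cot_counit_kgE. Qed.

Lemma colinear_tens_counit A (e : A = regbc H) X (h h' : grouplikes H) :
  h = grouplike1 H -> h' = grouplike1 H -> colinear (@tens_counit A e X h h').
Proof.
move=> h1 h1'.
apply: (colinear_comp (X := comod_tens X (comod_tens (cot A (kg h)) (kg h')))
  (Y := comod_tens X (kg h)) (Z := X) (f := tmap idfun (@cot_counit_kg A e (kg h) h')) (h := @tensk X)).
  apply: (colinear_tmap (X := X) (X' := X) (Y := comod_tens (cot A (kg h)) (kg h')) (Y' := kg h)).
    exact: colinear_id.
  exact: colinear_cot_counit_kg.
exact: colinear_tensk.
Qed.

(** H [] k_h is a line spanned by [j 1], the preimage of 1 under the counit, so only X remains. *)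
Lemma tens_counit_bij A (e : A = regbc H) X (h h' : grouplikes H) :
  bijective (@tens_counit A e X h h').
Proof.
have [j [_ jK]] := cot_counit_sect e (kg h).
exists (fun x => x *t (j 1 *t (1 : K^o))) => [|x]; last first.
  by rewrite tens_counitE jK mulr1 scale1r.
elim/tens_ind=> [x q|u v IHu IHv]; last by rewrite linearD tpureDl IHu IHv.
elim/tens_ind: q => [s k|u v IHu IHv].
  have ek : k = k *: (1 : K^o) by rewrite [RHS]mulr1.
  pose d : K := cot_counit e s; have es : s = d *: j 1.
    by apply: (@cot_counit_inj _ _ _ e); rewrite linearZ /= jK [RHS]mulr1.
  rewrite tens_counitE -/d; move: d es => d ->.
  by rewrite [in RHS]ek !(tpureZl, tpureZr) scalerA mulrC.
by rewrite tpureDr linearD tpureDl IHu IHv.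
Qed.

(** With Z = L_a [] X and [h] equal to g(a,1), the target is the comodule underlying [k,a] (x)
    [X,1]. *)
Definition wrapk Z (h : grouplikes H) (z : Z) :
    comod_tens (kg (grouplike1 H)) (comod_tens Z (kg h)) :=
  (1 : K^o) *t (z *t (1 : K^o)).

Lemma wrapk_is_linear Z h : linear (@wrapk Z h).
Proof. by move=> b u v; rewrite /wrapk tpureDl tpureZl tpureDr tpureZr. Qed.
HB.instance Definition _ Z h := GRing.isLinear.Build K _ _ _ (@wrapk Z h) (@wrapk_is_linear Z h).

Lemma colinear_wrapk Z (h : grouplikes H) : h = grouplike1 H -> colinear (@wrapk Z h).
Proof.
move=> -> z.
rewrite /= comod_tens_coactE /= comod_tens_coactE.
have bm := bilin_mul H; have bp := bilin_tpure Z K^o; have bp' := bilin_tpure K^o (tens Z K^o).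
rewrite /kg_coact.
elim/tens_ind: (coact z) => [b y|u v IHu IHv]; last by rewrite !tensD IHu IHv.
by rewrite !tmul2E // tmapE mul1r mulr1.
Qed.

Lemma wrapk_bij Z h : bijective (@wrapk Z h).
Proof.
exists (fun b : tens K^o (tens Z K^o) => tensk (tevall (idfun : K^o -> K^o) b)).
  by move=> t; rewrite /wrapk tevallE scale1r tenskE scale1r.
rewrite /wrapk; elim/tens_ind=> [x q|u v IHu IHv]; last first.
  by rewrite !linearD -[in RHS]IHu -[in RHS]IHv !tensD.
rewrite tevallE linearZ /= tpureZl tpureZr -tpureZl [x *: _]mulr1; congr (_ *t _).
elim/tens_ind: q => [t k|u v IHu IHv]; last by rewrite linearD tpureDl IHu IHv.
by rewrite tenskE tpureZl -tpureZr [k *: _]mulr1.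
Qed.
End MoreColinear.
Arguments tens_counit {K H A} e {X h h'} t.

(** The third factor is a multiple of 1 (x) 1, like the identifications attached to a trivial
    group-like: it contributes only the scalar [l]. *)
Lemma tmul2_collapse (K : fieldType) (A : falgType K) (X M Y : vectType K)
    (F : {linear tens X (tens M K^o) -> tens X Y}) (f : {linear M -> Y}) (l : K)
    (s : tens A X) (t : tens A M) :
  (forall x m, F (x *t (m *t (1 : K^o))) = x *t f m) ->
  tmap idfun F (tmul2 *%R (@tpure _ _ _) s (tmul2 *%R (@tpure _ _ _) t (l *: (1 *t (1 : K^o))))) =
  l *: tmul2 *%R (@tpure _ _ _) s (tmap idfun f t).
Proof.
move=> FE.
have bA := bilin_mul A; have bp := bilin_tpure X Y; have bp1 := bilin_tpure M K^o.
have bp2 := bilin_tpure X (tens M K^o).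
elim/tens_ind: s => [x x'|u v IHu IHv]; last by rewrite !tmul2Dl tmapD IHu IHv scalerDr.
elim/tens_ind: t => [z z'|u v IHu IHv].
  rewrite -tpureZl !tmul2E // !tmapE tmul2E // FE.
  by rewrite -!scalerAr mulr1 tpureZl.
by rewrite tmul2Dl tmul2Dr !tmapD tmul2Dr IHu IHv scalerDr.
Qed.

(** * Collapsing the hexagon axiom *)

Section Braid.
Variables (K : fieldType) (H : hopfAlg K) (Gamma : finGroupType).
Variable U : crossedDatum H Gamma.
Notation L := (cd_L U).
Notation g := (cd_g U).
Notation e1 := (cd_L1 U).
Notation k1 := (kg (grouplike1 H)).
Local Arguments gassoc {K H Gamma U} theta X Y Z _.

Lemma gtens_mapE (X X' Y Y' : gobj H Gamma) (f : {linear X.1 -> X'.1}) (h : {linear Y.1 -> Y'.1})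
   (x : X.1) (y : cot (L X.2) Y.1) (k : K^o) :
  gtens_map (U := U) f h (x *t (y *t k)) = f x *t (cotmap (degmap L X.2 X'.2) h y *t k).
Proof. by rewrite /gtens_map tmapE /= tmapE. Qed.

Lemma gtens_mapD (X X' Y Y' : gobj H Gamma) (f : X.1 -> X'.1) (h : Y.1 -> Y'.1) s t :
  gtens_map (U := U) f h (s + t) = gtens_map f h s + gtens_map f h t.
Proof. exact: tmapD. Qed.

Variables (theta : identifications U) (c : braiding theta).
Variable a : Gamma.

Let Ka : gobj H Gamma := (k1, a).
Let obj1 (X : comod H) : gobj H Gamma := (X, 1%g).

(** The map N_X: the component of the braiding at ([k,a], [X,1]), read through the two
    identifications above. *)
Definition brcot (X : comod H) (t : cot (L a) X) : X :=
  tens_counit e1 (c Ka (obj1 X) (wrapk (g a 1%g) t)).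

Lemma brcot_linear X : linear (@brcot X).
Proof. by move=> b u v; rewrite /brcot !linearP. Qed.
HB.instance Definition _ X := GRing.isLinear.Build K _ _ _ (@brcot X) (@brcot_linear X).

Lemma brcot_bij X : bijective (@brcot X).
Proof.
apply: (bij_comp (f := fun b : (gtens U (obj1 X) Ka).1 => tens_counit e1 b)).
  exact: tens_counit_bij.
apply: (bij_comp (br_bij c _ _)).
exact: wrapk_bij.
Qed.

Lemma ghom_id (X : gobj H Gamma) : ghom (idfun : X.1 -> X.1).
Proof. by split=> [|]; [exact: colinear_id | rewrite eqxx]. Qed.

Lemma brcot_colinear X : colinear (@brcot X).
Proof.
have [ga1 gb1] := cd_g1 U a.
apply: (colinear_comp (X := cot (L a) X) (Y := (gtens U Ka (obj1 X)).1) (Z := X)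
  (f := wrapk (g a 1%g)) (h := tens_counit e1 \o c Ka (obj1 X))).
  exact: colinear_wrapk.
apply: (colinear_comp (X := (gtens U Ka (obj1 X)).1) (Y := (gtens U (obj1 X) Ka).1) (Z := X)
  (f := c Ka (obj1 X)) (h := tens_counit e1)).
  exact: (br_hom c Ka (obj1 X)).1.
exact: colinear_tens_counit.
Qed.

(** This is naturality of the braiding in its second argument. The degree of [Z] is 1 by hypothesis
    and not by definition, which covers the degree 1 * 1 of [X,1] (x) [Y,1]. *)
Lemma brcot_gtens_map (X : comod H) (Z : gobj H Gamma) (f : {linear Z.1 -> X}) (t : cot (L a) Z.1) :
  colinear f -> Z.2 = 1%g ->
  brcot (cotmap idfun f t) =
  tens_counit e1 (gtens_map (U := U) (X := Z) (X' := obj1 X) (Y := Ka) (Y' := Ka) f idfun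
     (c Ka Z (wrapk (g a Z.2) t))).
Proof.
move=> fc Z1; rewrite /brcot.
have hf : ghom (X := Z) (Y := obj1 X) f by split=> //; rewrite Z1 eqxx.
rewrite -(br_nat c (ghom_id Ka) hf).
have -> // : gtens_map (U := U) (X := Ka) (X' := Ka) (Y := Z) (Y' := obj1 X) idfun f (wrapk (g a Z.2) t) =
  wrapk (g a 1%g) (cotmap idfun f t).
rewrite /wrapk (@gtens_mapE Ka Ka Z (obj1 X) idfun f) /=.
have E : (degmap L a a : L a -> L a) = idfun by apply: boolp.funext => x; rewrite degmap_id.
by rewrite E.
Qed.

Lemma cot_counit_scalar (h : grouplikes H) (s : cot (L 1%g) (kg h)) (k : K) :
  vsval s = k *: (1 *t (1 : K^o)) -> cot_counit e1 s = k.
Proof. by move=> e; rewrite /cot_counit e linearZ /= tevallE /= counit_cast1 scale1r [RHS](esym (mulr1 k)). Qed.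

Lemma cd_gamma_1l b d : cd_gamma U 1%g b d = 1.
Proof. by have [] := coc3_1 (cd_gamma_coc U) b d. Qed.
Lemma cd_gamma_1m b d : cd_gamma U b 1%g d = 1.
Proof. by have [] := coc3_1 (cd_gamma_coc U) b d. Qed.

Lemma gassocD X Y Z s t :
  gassoc theta X Y Z (s + t) = gassoc theta X Y Z s + gassoc theta X Y Z t.
Proof. exact: linearD. Qed.

Lemma tens_counitD Z h h' s t :
  @tens_counit _ _ _ e1 Z h h' (s + t) = tens_counit e1 s + tens_counit e1 t.
Proof. exact: linearD. Qed.

Lemma tens_counitZ Z h h' k s : @tens_counit _ _ _ e1 Z h h' (k *: s) = k *: tens_counit e1 s.
Proof. exact: linearZ. Qed.

Lemma brZ X Y k s : c X Y (k *: s) = k *: c X Y s.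
Proof. exact: linearZ. Qed.

Section Hex.
Variables X Y : comod H.

Definition gtens_counit : (gtens U (obj1 X) (obj1 Y)).1 -> comod_tens X Y :=
  tmap idfun (@cot_counit_kg _ _ _ e1 Y (g 1%g 1%g)).
HB.instance Definition _ :=
  GRing.Linear.copy gtens_counit (tmap idfun (@cot_counit_kg _ _ _ e1 Y (g 1%g 1%g))).

Lemma gtens_counitE (x : X) (y : cot (L 1%g) Y) (k : K^o) :
  gtens_counit (x *t (y *t k)) = x *t (k *: cot_counit e1 y).
Proof. by rewrite /gtens_counit tmapE; congr (_ *t _); exact: cot_counit_kgE. Qed.

Lemma colinear_gtens_counit : colinear gtens_counit.
Proof.
apply: (colinear_tmap (X := X) (X' := X) (Y := comod_tens (cot (L 1%g) Y) (kg (g 1%g 1%g))) (Y' := Y)).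
  exact: colinear_id.
by apply: colinear_cot_counit_kg; have [] := cd_g1 U 1%g.
Qed.

Definition nested_counit (m : comod_tens (cot (L 1%g) (gtens U (obj1 Y) Ka).1) (kg (g 1%g (1 * a)%g))) : Y :=
  tens_counit e1 (cot_counit_kg e1 m : (gtens U (obj1 Y) Ka).1).
Lemma nested_counit_is_linear : linear nested_counit.
Proof. by move=> b u v; rewrite /nested_counit linearP [LHS]linearP. Qed.
HB.instance Definition _ := GRing.isLinear.Build K _ _ _ nested_counit nested_counit_is_linear.

Lemma nested_counitE (m : cot (L 1%g) (gtens U (obj1 Y) Ka).1) (k : K^o) :
  nested_counit (m *t k) = k *: tens_counit e1 (cot_counit e1 m).
Proof. by rewrite /nested_counit cot_counit_kgE [LHS]linearZ. Qed.

(** Evaluates the final vertex of the hexagon, [X,1] (x) ([Y,1] (x) [k,a]), onto X (x) Y. *)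
Definition tens_nested_counit (p : (gtens U (obj1 X) (gtens U (obj1 Y) Ka)).1) : comod_tens X Y :=
  tmap idfun nested_counit p.

Lemma tens_nested_counitE (x : X) (m : cot (L 1%g) (gtens U (obj1 Y) Ka).1) (k : K^o) :
  tens_nested_counit (x *t (m *t k)) = x *t (k *: tens_counit e1 (cot_counit e1 m)).
Proof. by rewrite /tens_nested_counit tmapE; congr (_ *t _); exact: nested_counitE. Qed.

Lemma tens_nested_counitD s t :
  tens_nested_counit (s + t) = tens_nested_counit s + tens_nested_counit t.
Proof. exact: tmapD. Qed.

Lemma tens_nested_counitZ k s : tens_nested_counit (k *: s) = k *: tens_nested_counit s.
Proof. exact: linearZ. Qed.

(** On pure tensors [cd_gamma] is 1, the inverse of f^{1,1} reduces to a cast under the counit, and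
    products in L_1 become products of scalars. Of the constraint only the scalar of [theta]
    survives. *)
Lemma hexagon_lhs (c1 : K) (b : (gtens U (gtens U (obj1 X) (obj1 Y)) Ka).1) :
  vsval (theta 1%g 1%g a 1) = c1 *: (1 *t (1 : K^o)) ->
  tens_nested_counit (gassoc theta (obj1 X) (obj1 Y) Ka b) =
  c1 *: tens_counit e1 (gtens_map (U := U) (X := gtens U (obj1 X) (obj1 Y)) (X' := obj1 (comod_tens X Y))
     (Y := Ka) (Y' := Ka) gtens_counit idfun b).
Proof.
move=> /cot_counit_scalar th.
elim/tens_ind: b => [p q|u v IHu IHv]; last first.
  by rewrite gassocD tens_nested_counitD gtens_mapD tens_counitD IHu IHv scalerDr.
elim/tens_ind: p => [x p|u v IHu IHv]; last first.
  by rewrite tpureDl gassocD tens_nested_counitD gtens_mapD tens_counitD IHu IHv scalerDr.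
elim/tens_ind: p => [y k|u v IHu IHv]; last first.
  by rewrite tpureDr tpureDl gassocD tens_nested_counitD gtens_mapD tens_counitD IHu IHv scalerDr.
elim/tens_ind: q => [s l|u v IHu IHv]; last first.
  by rewrite tpureDr gassocD tens_nested_counitD gtens_mapD tens_counitD IHu IHv scalerDr.
rewrite gassocE cd_gamma_1l mul1r tens_nested_counitZ tens_nested_counitE scale1r.
rewrite !cot_counitM (fid_linv_1l (U := U) (a := 1%g)) tens_counitE th.
rewrite (etrans (@gtens_mapE (gtens U (obj1 X) (obj1 Y)) (obj1 (comod_tens X Y)) Ka Ka gtens_counit idfun
  _ s l) (congr1 (fun z => z *t _) (gtens_counitE x y k))) tens_counitE.
have ac (k' l' d w : K) : k' * l' * (d * w) = d * (l' * w) * k'.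
  by rewrite mulrCA -[RHS]mulrA; congr (_ * _); rewrite [RHS]mulrC mulrA.
by rewrite !tpureZr !scalerA; congr (_ *: _); exact: ac.
Qed.

(** The constraint for [X,1], [k,a], [Y,1] is evaluated in the same way; the braiding of [k,a] with
    [Y,1] that follows it produces [brcot]. *)
Lemma hexagon_rhs (c2 : K) (b : (gtens U (obj1 X) Ka).1) (s : cot (L (1 * a)%g) Y) :
  vsval (theta 1%g a 1%g 1) = c2 *: (1 *t (1 : K^o)) ->
  tens_nested_counit (gtens_map (U := U) (X := obj1 X) (X' := obj1 X) (Y := gtens U Ka (obj1 Y))
     (Y' := gtens U (obj1 Y) Ka) idfun (c Ka (obj1 Y))
     (gassoc theta (obj1 X) Ka (obj1 Y) (b *t (s *t (1 : K^o))))) =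
  c2 *: (tens_counit e1 b *t brcot (cotmap (degmap L (1 * a)%g a) idfun s)).
Proof.
move=> th.
elim/tens_ind: b => [x p|u v IHu IHv]; last first.
  by rewrite tpureDl gassocD gtens_mapD tens_nested_counitD tens_counitD IHu IHv tpureDl scalerDr.
elim/tens_ind: p => [y k|u v IHu IHv]; last first.
  by rewrite tpureDr tpureDl gassocD gtens_mapD tens_nested_counitD tens_counitD IHu IHv tpureDl scalerDr.
rewrite gassocE cd_gamma_1l mul1r mulr1.
rewrite -[k *: _]tpureZl.
rewrite (@gtens_mapE (obj1 X) (obj1 X) (gtens U Ka (obj1 Y)) (gtens U (obj1 Y) Ka) idfun (c Ka (obj1 Y))).
rewrite tens_nested_counitE scale1r.
rewrite cot_counit_cotmap; [|by move=> z; rewrite degmap_id|exact: (br_hom c Ka (obj1 Y)).1].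
rewrite !cot_counitM (fid_linv_1l (U := U) (a := a)) (cot_counit_scalar th) tens_counitE.
set w := cotmap (degmap L (1 * a)%g a) idfun s.
pose d : K := cot_counit e1 y.
(* The counit [d] of [y] and the scalar of [theta] are moved out, so that the braiding is applied to
   a multiple of [wrapk]. *)
have E : (d : K^o) *t (w *t (c2 : K^o)) = (d * c2) *: wrapk (g a 1%g) w.
  rewrite /wrapk.
  have {1}-> : c2 = c2 *: (1 : K^o) by rewrite [RHS]mulr1.
  have {1}-> : d = d *: (1 : K^o) by rewrite [RHS]mulr1.
  by rewrite !tpureZl !tpureZr scalerA; exact: erefl.
transitivity (idfun (k *: x) *t ((d * c2) *: brcot w)).
  congr (_ *t _); transitivity (tens_counit e1 (c Ka (obj1 Y) ((d * c2) *: wrapk (g a 1%g) w))).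
    by rewrite -E; exact: erefl.
  by rewrite brZ tens_counitZ.
rewrite -/d.
have ac (k' d' c' : K) : k' * (d' * c') = c' * (k' * d') by rewrite mulrA mulrC.
by rewrite !tpureZl !tpureZr !scalerA; congr (_ *: _); exact: ac.
Qed.

(** Here the product lives in L_a and is kept; f^{a,1} reduces to a cast and the identification to
    the scalar [l]. *)
Lemma hexagon_source (l : K) (y : cot (L a) X) (s : cot (L (a * 1)%g) Y) :
  vsval (theta a 1%g 1%g 1) = l *: (1 *t (1 : K^o)) ->
  cotmap idfun gtens_counit (cotmul y (cotmul (linv (@fid _ _ _ U a 1%g Y) s) (theta a 1%g 1%g 1))) =
  l *: cotmul y (cotmap (degmap L (a * 1)%g a) idfun s).
Proof.
move=> th; apply: subvs_inj.
rewrite (cotmapE (f := idfun) (h := gtens_counit));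
  [|exact: rcolinear_id|exact: colinear_gtens_counit].
have E (y' : cot (L a) X) (t : cot (L a) (cot (L 1%g) Y)) (u : cot (L a) (kg (g 1%g 1%g))) :
    vsval (cotmul y' (cotmul t u)) = tmul2 *%R (@tpure _ _ _) (vsval y')
       (tmul2 *%R (@tpure _ _ _) (vsval t) (vsval u)).
  by rewrite cotmulE; congr tmul2; exact: cotmulE.
transitivity (tmap idfun gtens_counit (tmul2 *%R (@tpure _ _ _) (vsval y)
   (tmul2 *%R (@tpure _ _ _) (vsval (linv (@fid _ _ _ U a 1%g Y) s)) (l *: (1 *t (1 : K^o)))))).
  by rewrite -th -E; exact: erefl.
clear E; rewrite [in RHS]linearZ /= cotmulE -fid_linv_1r.
rewrite (cotmapE (f := idfun) (h := cot_counit e1));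
  [|exact: rcolinear_id|exact: colinear_cot_counit].
have := @tmul2_collapse K (L a) X (cot (L 1%g) Y) Y gtens_counit (cot_counit e1) l (vsval y)
   (vsval (linv (@fid _ _ _ U a 1%g Y) s)).
apply => x z.
by rewrite -[X in _ = _ *t X]scale1r; exact: gtens_counitE.
Qed.
End Hex.

(** Under [tens_nested_counit], the first hexagon at [k,a], [X,1], [Y,1] reads c1 l N(yw) = c2 N(y)
    (x) N(w). *)
Lemma brcot_mul : exists2 kappa :
  K, kappa != 0 & forall (X Y : comod H) (y : cot (L a) X) (w : cot (L a) Y),
  brcot (cotmul y w) = kappa *: (brcot y *t brcot w).
Proof.
have [g1a ga1] := cd_g1 U a; have [g11 _] := cd_g1 U 1%g.
have [l l0 thl] := theta_scalar theta a g11.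
have [c1 c10 thc1] := theta_scalar theta 1%g g1a.
have [c2 c20 thc2] := theta_scalar theta 1%g ga1.
(* One scalar for each associativity constraint: [c1], [l], [c2] come from the identifications at
   (1,1,a), (a,1,1), (1,a,1). *)
exists ((c1 * l)^-1 * c2).
  by rewrite mulf_neq0 // invr_eq0 mulf_neq0.
move=> X Y y w.
pose s : cot (L (a * 1)%g) Y := cotmap (degmap L a (a * 1)%g) idfun w.
have sw : cotmap (degmap L (a * 1)%g a) idfun s = w.
  by rewrite cot_degmapK // mulg1.
pose t : (gtens U (gtens U Ka (obj1 X)) (obj1 Y)).1 := wrapk (g a 1%g) y *t (s *t (1 : K^o)).
have := congr1 (@tens_nested_counit X Y) (br_hex1 c t).
have -> : gassoc theta Ka (obj1 X) (obj1 Y) t =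
    wrapk (g a (1 * 1)%g) (cotmul y (cotmul (linv (@fid _ _ _ U a 1%g Y) s) (theta a 1%g 1%g 1))).
  by rewrite gassocE cd_gamma_1m !mulr1 scale1r.
rewrite (hexagon_lhs _ thc1).
rewrite -(@brcot_gtens_map _ (gtens U (obj1 X) (obj1 Y)) (@gtens_counit X Y));
  [|exact: colinear_gtens_counit|exact: mulg1].
rewrite (hexagon_source _ _ thl) sw.
have -> : @gtens_map _ _ _ U (gtens U Ka (obj1 X)) (gtens U (obj1 X) Ka) (obj1 Y) (obj1 Y) (c Ka (obj1 X)) idfun t =
    c Ka (obj1 X) (wrapk (g a 1%g) y) *t (cotmap (degmap L (a * 1)%g (1 * a)%g) idfun s *t (1 : K^o)).
  exact: (@gtens_mapE (gtens U Ka (obj1 X)) (gtens U (obj1 X) Ka) (obj1 Y) (obj1 Y) (c Ka (obj1 X)) idfun).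
rewrite (hexagon_rhs _ _ thc2).
(* The braiding moves the first two factors from degree a * 1 to 1 * a; the successive casts of [s]
   compose to a single one. *)
have ea : (a * 1 = 1 * a)%g by rewrite mulg1 mul1g.
rewrite cotmap_comp; try exact: colinear_id; try (apply: degmap_rcolinear; rewrite ?mul1g ?mulg1 //).
have -> : (degmap L (1 * a)%g a \o degmap L (a * 1)%g (1 * a)%g : L (a * 1)%g -> L a) =
    degmap L (a * 1)%g a.
  by apply: boolp.funext => x; rewrite [LHS](degmap_comp ea (mul1g a)).
rewrite [cotmap _ _ s]sw -[tens_counit e1 _]/(brcot y) linearZ /= scalerA => E.
by rewrite -scalerA -E scalerA mulVf ?scale1r // mulf_neq0.
Qed.

Lemma brcot_natural (X Y : comod H) (f : {linear X -> Y}) (t : cot (L a) X) :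
  colinear f -> brcot (cotmap idfun f t) = f (brcot t).
Proof.
move=> fc; rewrite (@brcot_gtens_map Y (obj1 X) f) // /brcot.
move: (c Ka (obj1 X) _) => b.
elim/tens_ind: b => [x p|u v IHu IHv]; last by rewrite gtens_mapD !tens_counitD linearD IHu IHv.
elim/tens_ind: p => [s k|u v IHu IHv];
  last by rewrite tpureDr gtens_mapD !tens_counitD linearD IHu IHv.
rewrite (@gtens_mapE (obj1 X) (obj1 Y) Ka Ka f idfun) !tens_counitE linearZ /=.
by rewrite (_ : (degmap L 1%g 1%g : L 1%g -> L 1%g) = idfun) ?cotmap_id //;
  apply: boolp.funext => z; rewrite degmap_id.
Qed.

End Braid.

(** * From a monoidal natural isomorphism to an isomorphism with H *)

Section IsoOfNat.
Variables (K : fieldType) (H : hopfAlg K) (A : bicomodAlg H).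
Variable N : forall X : comod H, {linear cot A X -> X}.
Hypothesis N_bij : forall X, bijective (N X).
Hypothesis N_colinear : forall X, colinear (N X).
Hypothesis N_nat : forall (X Y : comod H) (f : {linear X -> Y}) t, colinear f ->
  N Y (cotmap idfun f t) = f (N X t).
Variable kappa : K.
Hypothesis kappa0 : kappa != 0.
Hypothesis N_mul : forall (X Y : comod H) (s : cot A X) (t : cot A Y),
  N _ (cotmul s t) = kappa *: (N X s *t N Y t).

Let HH : comod H := lcomod (regbc H).

(** The canonical isomorphism from A to A [] H, inverted by the counit of H. *)
Definition rco_cot (x : A) : cot A HH := vsproj _ (rco A x).
HB.instance Definition _ := GRing.Linear.copy rco_cot (vsproj (cot_space A HH) \o rco A).

Lemma rco_cotE x : vsval (rco_cot x) = rco A x.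
Proof. by rewrite vsprojK //; apply/mem_cot; exact: rcoA. Qed.

Lemma rco_cot_bij : bijective rco_cot.
Proof.
have rco_cotK : cancel rco_cot (fun t => tevalr (counit H) (vsval t)).
  by move=> x; rewrite rco_cotE rco1.
exists (fun t => tevalr (counit H) (vsval t)) => // t.
apply: subvs_inj; rewrite rco_cotE.
transitivity (tmap idfun (tevalr (counit H)) (tassoc (tmap (rco A) idfun (vsval t)))).
  elim/tens_ind: (vsval t) => [x h|u v IHu IHv]; last by rewrite !linearD /= IHu IHv.
  rewrite tmapE /= tevalrE linearZ /=.
  elim/tens_ind: (rco A x) => [a b|u v IHu IHv]; last first.
    by rewrite tpureDl scalerDr !linearD /= IHu IHv.
  by rewrite tassocE tmapE /= tevalrE tpureZr.
have e := @cotP K H A HH t; rewrite [tassoc _]e tmap_comp -[RHS]tmap_id; apply: eq_tmap => // h.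
exact: counitr.
Qed.

Lemma rco_cot_colinear : colinear (rco_cot : lcomod A -> cot A HH).
Proof.
move=> x.
apply: (tmap_injr (f := vsval) (g := vsproj (cot_space A HH))); first exact: vsvalK.
rewrite [LHS](@cot_coactE K H A HH) rco_cotE tmap_comp /cot_Lambda.
rewrite [LHS](@lrco K H A); apply: eq_tmap => // y.
by rewrite /= rco_cotE.
Qed.

Definition to_reg (x : A) : regbc H := N HH (rco_cot x).

Lemma to_reg_linear : linear to_reg.
Proof. by move=> b x y; rewrite /to_reg !linearP. Qed.
HB.instance Definition _ := GRing.isLinear.Build K A (regbc H) _ to_reg to_reg_linear.

Lemma to_reg_bij : bijective to_reg.
Proof. exact: bij_comp (N_bij HH) rco_cot_bij. Qed.

Lemma to_reg_lco x : lco (regbc H) (to_reg x) = tmap idfun to_reg (lco A x).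
Proof.
have := N_colinear (rco_cot x); rewrite rco_cot_colinear tmap_comp; exact.
Qed.

(** For a functional p on H, h |-> h_1 p(h_2) is a left colinear endomorphism of H. Naturality of
    [N] along it is the claim with p applied to the right leg. *)
Lemma to_reg_rco x : rco (regbc H) (to_reg x) = tmap to_reg idfun (rco A x).
Proof.
apply: eq_tevalr => p.
pose r (h : HH) : HH := tevalr p (comul H h).
have r_lin : linear r by move=> b u v; rewrite /r !linearP.
pose R : {linear HH -> HH} := HB.pack r (GRing.isLinear.Build _ _ _ _ _ r_lin).
have Rc : colinear R.
  move=> h.
  transitivity (tmap idfun (tevalr p) (tmap idfun (comul H) (comul H h))); last first.
    by rewrite tmap_comp; apply: eq_tmap.
  rewrite -comulA /= /r.
  elim/tens_ind: (comul H h) => [a b|u v IHu IHv]; last by rewrite !linearD /= IHu IHv.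
  rewrite tevalrE tmapE linearZ /=.
  elim/tens_ind: (comul H a) => [a1 a2|u v IHu IHv]; last first.
    by rewrite tpureDl scalerDr !linearD /= IHu IHv.
  by rewrite tassocE tmapE /= tevalrE tpureZr.
have := N_nat (rco_cot x) Rc.
have -> : cotmap idfun R (rco_cot x) = rco_cot (tevalr p (rco A x)).
  apply: subvs_inj; rewrite rco_cotE cotmapE //; last exact: rcolinear_id.
  rewrite rco_cotE.
  transitivity (tmap idfun (tevalr p) (tmap idfun (comul H) (rco A x))).
    by rewrite tmap_comp; apply: eq_tmap.
  rewrite -rcoA.
  elim/tens_ind: (rco A x) => [a b|u v IHu IHv]; last by rewrite !linearD /= IHu IHv.
  rewrite tevalrE tmapE linearZ /=.
  elim/tens_ind: (rco A a) => [a1 a2|u v IHu IHv]; last first.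
    by rewrite tpureDl scalerDr !linearD /= IHu IHv.
  by rewrite tassocE tmapE /= tevalrE tpureZr.
rewrite -/(to_reg _) -/(to_reg _) => E.
rewrite -[LHS]E.
elim/tens_ind: (rco A x) => [a b|u v IHu IHv]; last by rewrite !linearD /= IHu IHv.
by rewrite tmapE !tevalrE linearZ.
Qed.

(** The multiplication H (x) H -> H is colinear because the comultiplication is multiplicative;
    naturality along it transfers the multiplicativity of [N]. *)
Lemma to_regM x y : to_reg (x * y) = kappa *: (to_reg x * to_reg y).
Proof.
pose m : tens H H -> H := tlift *%R.
pose M : {linear comod_tens HH HH -> HH} := HB.pack m (GRing.Linear.copy m (tlift *%R)).
have ME u v : m (u *t v) = u * v by rewrite /m tliftE //; exact: bilin_mul.
have mD u v : m (u + v) = m u + m v by exact: linearD.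
have bm := bilin_mul H; have bp := bilin_tpure H H; have bA := bilin_mul A.
have mul_m (s t : tens H H) : s * t = tmap idfun m (tmul2 *%R (@tpure K H H) s t).
  elim/tens_ind: s => [a b|u v IHu IHv]; last by rewrite mulrDl IHu IHv tmul2Dl tmapD.
  elim/tens_ind: t => [a' b'|u v IHu IHv]; last by rewrite mulrDr IHu IHv tmul2Dr tmapD.
  by rewrite tpureM tmul2E // (tmapE idfun M) /= ME.
have mul_mA (s t : tens A H) : s * t = tmap idfun m (tmul2 *%R (@tpure K H H) s t).
  elim/tens_ind: s => [a b|u v IHu IHv]; last by rewrite mulrDl IHu IHv tmul2Dl tmapD.
  elim/tens_ind: t => [a' b'|u v IHu IHv]; last by rewrite mulrDr IHu IHv tmul2Dr tmapD.
  by rewrite tpureM tmul2E // (tmapE idfun M) /= ME.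
have Mc : colinear M.
  elim/tens_ind=> [a b|u v IHu IHv]; last by rewrite !linearD /= IHu IHv.
  by rewrite /= comod_tens_coactE ME rmorphM mul_m.
have E : rco_cot (x * y) = cotmap idfun M (cotmul (rco_cot x) (rco_cot y)).
  apply: subvs_inj; rewrite cotmapE //; last exact: rcolinear_id.
  by rewrite cotmulE !rco_cotE rmorphM mul_mA.
rewrite /to_reg E N_nat // N_mul.
by rewrite linearZ /= ME.
Qed.

(** Multiplying [to_reg] by [kappa] absorbs the scalar in [to_regM]. *)
Lemma iso_of_nat : exists psi : {lrmorphism A -> regbc H}, bicomodAlg_iso psi.
Proof.
pose psi x : regbc H := kappa *: to_reg x.
have psi_lin : linear psi by move=> b x y; rewrite /psi linearP scalerDr !scalerA mulrC.
have psiM : {morph psi : x y / x * y}.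
  by move=> x y; rewrite /psi to_regM -!scalerAl -!scalerAr.
have psi_bij : bijective psi.
  have [s sK Ks] := to_reg_bij.
  exists (fun y => s (kappa^-1 *: y)) => y.
    by rewrite /psi scalerA mulVf // scale1r sK.
  by rewrite /psi Ks scalerA mulfV // scale1r.
(* As [psi] is multiplicative and onto, [psi 1] is neutral in H. *)
have psi1 : psi 1 = 1.
  have [s sK Ks] := psi_bij.
  by rewrite -[LHS]mulr1 -{1}(Ks 1) -psiM mul1r Ks.
pose P : {lrmorphism A -> regbc H} := HB.pack psi (GRing.isLinear.Build _ _ _ _ _ psi_lin)
  (GRing.isMonoidMorphism.Build _ _ psi (conj psi1 psiM)).
exists P; split=> // x.
- rewrite /= /psi linearZ /= [comul H _]to_reg_lco.
  elim/tens_ind: (lco A x) => [a b|u v IHu IHv]; last by rewrite !linearD /= IHu IHv.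
  by rewrite (tmapE idfun P) (tmapE idfun to_reg) -tpureZr.
- rewrite /= /psi linearZ /= [comul H _]to_reg_rco.
  elim/tens_ind: (rco A x) => [a b|u v IHu IHv]; last by rewrite !linearD /= IHu IHv.
  by rewrite (tmapE P idfun) (tmapE to_reg idfun) -tpureZl.
Qed.
End IsoOfNat.

(** * Transporting the crossed datum *)

Section IsoCalculus.
Variables (K : fieldType) (H : hopfAlg K).
Implicit Types A B C : bicomodAlg H.

Lemma bicomodAlg_iso_comp A B C (f : {lrmorphism A -> B}) (h : {lrmorphism B -> C}) :
  bicomodAlg_iso f -> bicomodAlg_iso h -> bicomodAlg_iso (h \o f).
Proof.
move=> [fb fl fr] [hb hl hr]; split; first exact: bij_comp.
- by move=> x /=; rewrite hl fl tmap_comp.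
- by move=> x /=; rewrite hr fr tmap_comp.
Qed.

Lemma bicomodAlg_iso_inv A B (f : {lrmorphism A -> B}) : bicomodAlg_iso f ->
  exists h : {lrmorphism B -> A}, [/\ bicomodAlg_iso h, cancel f h & cancel h f].
Proof.
move=> [[h fK hK] fl fr].
pose P : {lrmorphism B -> A} := HB.pack h
  (GRing.isLinear.Build _ _ _ _ _ (can2_linear fK hK))
  (GRing.isMonoidMorphism.Build _ _ h (can2_monoid_morphism fK hK)).
exists P; split=> //; split; first by exists f.
- move=> y; rewrite -{2}[y]hK fl tmap_comp -[LHS]tmap_id.
  by apply: eq_tmap => // z; rewrite /= fK.
- move=> y; rewrite -{2}[y]hK fr tmap_comp -[LHS]tmap_id.
  by apply: eq_tmap => // z; rewrite /= fK.
Qed.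

Lemma bicomodAlg_iso_twist A B (f : {lrmorphism A -> B}) (g : grouplikes H) :
  bicomodAlg_iso f -> bicomodAlg_iso (f : {lrmorphism twist A g -> twist B g}).
Proof.
move=> [fb fl fr]; split=> // x.
rewrite [LHS](_ : _ = tmap (conjV g) idfun (lco B (f x))) // fl.
by rewrite /= /twist_lco /= !tmap_comp; apply: eq_tmap.
Qed.

Lemma bccast_iso A B (e : A = B) :
  exists psi : {lrmorphism A -> B}, bicomodAlg_iso psi /\ psi =1 bccast e.
Proof.
subst B; exists idfun; split=> //; split; first by exists idfun.
- by move=> x; rewrite tmap_id.
- by move=> x; rewrite tmap_id.
Qed.

(** The coactions are compared on the nonzero vector [f 1]. *)
Lemma kg_colinear_eq (h g : grouplikes H) (f : {linear kg h -> kg g}) :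
  colinear f -> bijective f -> h = g.
Proof.
move=> fc /bij_inj fi.
have fn : f (1 : K^o) != (0 : K^o).
  by rewrite -(linear0 f) (inj_eq fi) oner_eq0.
have e : val g *t (f 1 : K^o) = val h *t (f 1 : K^o).
  by have := fc (1 : K^o); rewrite /= /kg_coact tmapE.
apply: val_inj.
have /= := congr1 (tensk (V := H)) e.
by rewrite !tenskE => /(scalerI fn).
Qed.

(** [N] makes g a candidate in the choice defining [phi]; any other candidate h gives k_h isomorphic
    to k_g, hence equals g. *)
Lemma phi_unique A (g : grouplikes H) (N : {linear cot A (kg g) -> kg g}) :
  colinear N -> bijective N -> phi A g = g.
Proof.
move=> Nc [N' NK N'K].
pose P : {linear kg g -> cot A (kg g)} := HB.pack N'
  (GRing.isLinear.Build _ _ _ _ _ (can2_linear NK N'K)).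
apply: classical_sets.xget_unique.
  exists P; split; first by exists N.
  move=> x; rewrite -{2}[x]N'K Nc tmap_comp -[LHS]tmap_id.
  by apply: eq_tmap => // z; rewrite /= NK.
move=> h [f [fb fc]].
apply: (@kg_colinear_eq h g (N \o f)).
  exact: colinear_comp.
by apply: bij_comp => //; exists N'.
Qed.

(** * Identification of H with A [] B when A and B are isomorphic to H *)

Section Sect.
Variables (A B : bicomodAlg H).
Variables (pA : {lrmorphism A -> regbc H}) (pB : {lrmorphism B -> regbc H}).
Variables (qA : {lrmorphism regbc H -> A}) (qB : {lrmorphism regbc H -> B}).
Hypotheses (qA_iso : bicomodAlg_iso qA) (qB_iso : bicomodAlg_iso qB).
Hypotheses (pA_iso : bicomodAlg_iso pA) (pB_iso : bicomodAlg_iso pB).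
Hypotheses (pAK : cancel pA qA) (pBK : cancel pB qB) (qAK : cancel qA pA) (qBK : cancel qB pB).

Definition reg_to_cot (h : regbc H) : cotalg A B := vsproj _ (tmap qA qB (comul H h)).
HB.instance Definition _ := GRing.Linear.copy reg_to_cot (vsproj (cot_aspace A B) \o tmap qA qB \o comul H).

Lemma reg_to_cotE h : vsval (reg_to_cot h) = tmap qA qB (comul H h).
Proof.
rewrite vsprojK //; apply/mem_cota.
transitivity (tmap qA (tmap idfun qB) (tassoc (tmap (comul H) idfun (comul H h)))).
  rewrite -tassoc_nat !tmap_comp; congr tassoc; apply: eq_tmap => // x.
  exact: (bci_rco qA_iso).
rewrite comulA !tmap_comp; apply: eq_tmap => // x; rewrite /=.
by rewrite (bci_lco qB_iso).
Qed.

Lemma reg_to_cot_monoid_morphism : monoid_morphism reg_to_cot.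
Proof.
split=> [|x y]; apply: subvs_inj; first by rewrite reg_to_cotE !rmorph1.
by rewrite [RHS]rmorphM /= !reg_to_cotE !rmorphM.
Qed.
Definition reg_to_cot_lr : {lrmorphism regbc H -> cotalg A B} :=
  HB.pack reg_to_cot (GRing.isMonoidMorphism.Build _ _ reg_to_cot reg_to_cot_monoid_morphism).

(** After transport of [t] to H [] H, the coproduct is inverse to the counit on the first leg. *)
Lemma reg_to_cotK (t : cotalg A B) : reg_to_cot (tevall (counit H) (tmap pA pB (vsval t))) = t.
Proof.
apply: subvs_inj; rewrite reg_to_cotE.
pose t' : cot (regbc H) (lcomod (regbc H)) := cotmap pA (pB : lcomod B -> lcomod (regbc H)) t.
have t'E : vsval t' = tmap pA pB (vsval t).
  by apply: (@cotmapE K H A (regbc H) (lcomod B) (lcomod (regbc H)) pA pB t);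
    [exact: (bci_rco pA_iso) | exact: (bci_lco pB_iso)].
have e := coact_cot_counit t'.
rewrite /cot_counit t'E in e.
rewrite [comul H _]e tmap_comp -[RHS]tmap_id; apply: eq_tmap => x; [exact: pAK | exact: pBK].
Qed.

Lemma reg_to_cot_iso : bicomodAlg_iso reg_to_cot_lr.
Proof.
split; rewrite /reg_to_cot_lr /=.
- exists (fun t => tevall (counit H) (tmap pA pB (vsval t))); last exact: reg_to_cotK.
  move=> h; rewrite reg_to_cotE tmap_comp.
  rewrite (_ : tmap _ _ _ = comul H h) ?counitl //.
  by rewrite -[RHS]tmap_id; apply: eq_tmap => x; [exact: qAK | exact: qBK].
- move=> h.
  apply: (tmap_injr (f := vsval) (g := vsproj (cot_aspace A B))); first exact: vsvalK.
  rewrite [LHS](@cot_lcoE K H A B) reg_to_cotE tmap_comp.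
  transitivity (tmap idfun (tmap qA qB) (tassoc (tmap (comul H) idfun (comul H h)))).
    rewrite -tassoc_nat !tmap_comp; congr tassoc; apply: eq_tmap => // x.
    by rewrite /= (bci_lco qA_iso).
  by rewrite comulA !tmap_comp; apply: eq_tmap => // x; rewrite /= reg_to_cotE.
- move=> h.
  apply: (tmap_injl (f := vsval) (g := vsproj (cot_aspace A B))); first exact: vsvalK.
  rewrite [LHS](@cot_rcoE K H A B) reg_to_cotE tmap_comp /cot_rLambda.
  transitivity (tmap (tmap qA qB) idfun (tassocV (tmap idfun (comul H) (comul H h)))).
    rewrite tmap_comp.
    elim/tens_ind: (comul H h) => [a b|u v IHu IHv]; last by rewrite !linearD /= IHu IHv.
    rewrite !tmapE /= (bci_rco qB_iso) /=.
    elim/tens_ind: (comul H b) => [b1 b2|u v IHu IHv]; last by rewrite !tensD IHu IHv.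
    by rewrite tassocVE !tmapE /= tassocVE tmapE.
  by rewrite -comulA tassocK !tmap_comp; apply: eq_tmap => // x; rewrite /= reg_to_cotE.
Qed.
End Sect.
End IsoCalculus.

(** * The transported maps f^{a,b} and their compatibility *)

Section Transport.
Variables (K : fieldType) (H : hopfAlg K) (Gamma : finGroupType).
Variable U : crossedDatum H Gamma.
Notation L := (cd_L U).
Notation g := (cd_g U).
Variables (p : forall a, {lrmorphism L a -> regbc H}) (q : forall a, {lrmorphism regbc H -> L a}).
Hypotheses (p_iso : forall a, bicomodAlg_iso (p a)) (q_iso : forall a, bicomodAlg_iso (q a)).
Hypotheses (pK : forall a, cancel (p a) (q a)) (qK : forall a, cancel (q a) (p a)).
Hypothesis p1 : p 1%g =1 bccast (cd_L1 U).
Hypothesis phi_g : forall a b c, phi (L a) (g b c) = g b c.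

Definition cd_reg a b : {lrmorphism regbc H -> cotalg (L a) (L b)} :=
  reg_to_cot_lr (q_iso a) (q_iso b).

Lemma cd_regE a b h : vsval (cd_reg a b h) = tmap (q a) (q b) (comul H h).
Proof. exact: reg_to_cotE. Qed.

Lemma cd_reg_iso a b : bicomodAlg_iso (cd_reg a b).
Proof. by apply: (@reg_to_cot_iso _ _ _ _ (p a) (p b)). Qed.

(** A twist changes only the left coaction, so [cd_reg] is also an algebra map between the
    twists. *)
Definition transported_f a b : {lrmorphism twist (regbc H) (g a b) -> regbc H} :=
  p (a * b)%g \o (cd_f U a b \o
    (cd_reg a b : {lrmorphism twist (regbc H) (g a b) -> twist (cotalg (L a) (L b)) (g a b)})).

Lemma transported_f_iso a b : bicomodAlg_iso (transported_f a b).
Proof.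
apply: bicomodAlg_iso_comp; last exact: p_iso.
apply: bicomodAlg_iso_comp; last exact: cd_f_iso.
exact/bicomodAlg_iso_twist/cd_reg_iso.
Qed.

Lemma p_degmap a b (e : a = b) x : p b (degmap L a b x) = p a x.
Proof. by subst; rewrite degmap_id. Qed.

(** The compatibility in [U] is applied to the image of h_1 (x) h_2 (x) h_3 in L_a [] L_b [] L_c,
    and both sides are carried back to H. *)
Lemma transported_f2 a b c (h : H) :
  transported_f (a * b)%g c (transported_f a b h) = transported_f a (b * c)%g (transported_f b c h).
Proof.
pose u : L a := q a (val (g b c)).
have gu := grouplike_unit (g b c).
have u_unit : u \is a GRing.unit by exact: rmorph_unit.
have u0 : u != 0 by apply: contraTneq u_unit => ->; rewrite unitr0.
have ru : rco (L a) u = u *t val (g b c).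
  by rewrite (bci_rco (q_iso a)) /= (grouplikeP _).1 tmapE.
pose d : cot (regbc H) (lcomod (regbc H)) := vsproj _ (comul H h).
have dE : vsval d = comul H h.
  by rewrite vsprojK //; apply/mem_cot; exact: comulA.
pose t : cot (L a) (cot (L b) (lcomod (L c))) :=
  cotmap (q a) (cd_reg b c : lcomod (regbc H) -> cot (L b) (lcomod (L c))) d.
have tE : vsval t = tmap (q a) (cd_reg b c) (comul H h).
  rewrite -dE.
  apply: (@cotmapE K H _ _ (lcomod (regbc H)) (cot (L b) (lcomod (L c))) (q a) (cd_reg b c) d).
    exact: (bci_rco (q_iso a)).
  exact: (bci_lco (cd_reg_iso b c)).
have := cd_f2 u0 ru t.
set E1 := cotmap _ _ (cotassocV t); set E2 := cotmap _ _ t.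
(* By right colinearity of the transported f, the tensor f(h_1) (x) h_2 is the coproduct of f(h). *)
have -> : E1 = cd_reg (a * b)%g c (transported_f a b h).
  apply: subvs_inj; rewrite cd_regE.
  have fE : comul H (transported_f a b h) = tmap (transported_f a b) idfun (comul H h).
    exact: (bci_rco (transported_f_iso a b)).
  rewrite fE tmap_comp.
  pose w := @cotassocV K H (L a) (L b) (lcomod (L c)) t.
  have wE : vsval w = tmap (cd_reg a b) (q c) (comul H h).
    apply: (tmap_injl (f := vsval) (g := vsproj (cot_aspace (L a) (L b)))); first exact: vsvalK.
    rewrite [LHS]cotassocVE tE tmap_comp.
    transitivity (tassocV (tmap (q a) (tmap (q b) (q c)) (tmap idfun (comul H) (comul H h)))).
      by rewrite tmap_comp; congr tassocV; apply: eq_tmap => // x; rewrite /= cd_regE.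
    rewrite -comulA -tassoc_nat tassocK !tmap_comp; apply: eq_tmap => // x.
    by rewrite /= cd_regE.
  rewrite /E1 (@cotmapE K H (cotalg (L a) (L b)) (L (a * b)%g) (lcomod (L c)) (lcomod (L c))
     (cd_f U a b) idfun); [|exact: cd_f_rcolinear|exact: colinear_id].
  rewrite wE tmap_comp; apply: eq_tmap => // x.
  by rewrite /= pK.
(* Conjugation by [u] is in general not right colinear, so [cotmapE] is avoided: both sides are
   projections of one tensor, by left colinearity of the transported f for the twisted coaction. *)
have -> : E2 = cd_reg a (b * c)%g (transported_f b c h).
  rewrite /E2 /cotmap tE.
  rewrite -[RHS]/(vsproj _ (tmap (q a) (q (b * c)%g) (comul H (transported_f b c h)))).
  have fE : comul H (transported_f b c h) = tmap idfun (transported_f b c) (tmap (conjV (g b c)) idfun (comul H h)).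
    exact: (bci_lco (transported_f_iso b c)).
  rewrite fE; congr (vsproj _ _).
  have hE x : u^-1 * q a x * u = q a (conjV (g b c) x) by rewrite /conjV !rmorphM /= rmorphV.
  have kE x : q (b * c)%g (transported_f b c x) = cd_f U b c (cd_reg b c x) by exact: pK.
  have J_lin : linear (fun x : L a => u^-1 * x * u).
    by move=> k x y; rewrite mulrDr mulrDl -scalerAr -scalerAl.
  pose J : {linear L a -> L a} := HB.pack (fun x : L a => u^-1 * x * u)
    (GRing.isLinear.Build _ _ _ _ _ J_lin).
  rewrite !tmap_comp.
  have -> := @tmap_comp K H (L a) (L a) H (cotalg (L b) (L c)) (L (b * c)%g)
    (q a) J (cd_reg b c) (cd_f U b c) (comul H h).
  by apply: eq_tmap => x; [exact: hE | exact: (esym (kE x))].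
move=> /(congr1 (p (a * (b * c))%g)).
by rewrite p_degmap ?mulgA.
Qed.

Lemma transport :
  exists (g : Gamma -> Gamma -> grouplikes H)
             (f : forall a b : Gamma, {lrmorphism twist (regbc H) (g a b) -> regbc H})
             (gamma : Gamma -> Gamma -> Gamma -> K),
        Hdatum f gamma /\ comes_from U f gamma.
Proof.
exists g, transported_f, (cd_gamma U); split.
  split.
  (* As phi(L_a, -) fixes g(b,c), the condition on g is the 2-cocycle condition. *)
  - by move=> a b c; rewrite -(cd_g2 U) phi_g.
  - exact: cd_g1.
  - exact: transported_f_iso.
  - exact: transported_f2.
  - exact: cd_gamma_coc.
exists p; split=> // a b t.
rewrite /transported_f /=; congr (p _ (cd_f U a b _)).
by rewrite [RHS](reg_to_cotK (q_iso a) (q_iso b) (p_iso a) (p_iso b)).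
Qed.
End Transport.

(** * Consequences of a braiding *)

Section Braided.
Variables (K : fieldType) (H : hopfAlg K) (Gamma : finGroupType).
Variable U : crossedDatum H Gamma.
Notation L := (cd_L U).
Notation g := (cd_g U).
Variables (theta : identifications U) (c : braiding theta).

(** If ab and ba differed, the braiding of [k,a] with [k,b] would be zero and bijective, while its
    source contains the nonzero element given by 1 (x) 1. *)
Lemma braided_abelian (a b : Gamma) : (a * b)%g = (b * a)%g.
Proof.
apply/eqP; apply/negPn/negP => ab.
pose w : cot (L a) (kg (grouplike1 H)) := vsproj _ (1 *t (1 : K^o)).
have w0 : w != 0.
  apply/eqP => /(congr1 vsval).
  rewrite vsprojK; last first.
    by apply/mem_cot; rewrite !tmapE rmorph1 -tpure1 tassocE.
  by apply/eqP; rewrite linear0 tpure_neq0 // oner_eq0.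
pose Ka : gobj H Gamma := (kg (grouplike1 H), a).
pose Kb : gobj H Gamma := (kg (grouplike1 H), b).
have [_ br0] := br_hom c Ka Kb.
have := br0 ab (wrapk (g a b) w); rewrite -(linear0 (c Ka Kb)).
move/(bij_inj (br_bij c Ka Kb)).
rewrite -(linear0 (wrapk (g a b))) => /(bij_inj (@wrapk_bij _ _ _ _)).
by move/eqP: w0.
Qed.

Lemma braided_iso (a : Gamma) :
  exists psi : {lrmorphism L a -> regbc H}, bicomodAlg_iso psi.
Proof.
have [kappa k0 km] := brcot_mul c a.
apply: (@iso_of_nat _ _ _ (fun X => brcot c (a := a) (X := X)) _ _ _ kappa k0) => //.
- by move=> X; exact: brcot_bij.
- by move=> X; exact: brcot_colinear.
- by move=> X Y f t fc; exact: brcot_natural.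
Qed.

(** At X = k_{g(b,d)}, [brcot] is a comodule isomorphism from L_a [] X to X. *)
Lemma braided_phi a b d : phi (L a) (g b d) = g b d.
Proof.
exact: (phi_unique (N := @brcot _ _ _ _ _ c a _) (@brcot_colinear _ _ _ _ _ c a _) (@brcot_bij _ _ _ _ _ c a _)).
Qed.
End Braided.

(** In degree 1 the isomorphism is replaced by the given identification of L_1 with H, as [tr_psi1]
    demands; the cast expresses this for a variable [a]. *)
Lemma bicomodAlg_iso_cd_L1 (K : fieldType) (H : hopfAlg K) (Gamma : finGroupType)
    (U : crossedDatum H Gamma) (a : Gamma) :
  (exists psi : {lrmorphism cd_L U a -> regbc H}, bicomodAlg_iso psi) ->
  exists psi : {lrmorphism cd_L U a -> regbc H}, bicomodAlg_iso psi /\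
    forall x, 1%g = a -> psi (degmap (cd_L U) 1%g a x) = bccast (cd_L1 U) x.
Proof.
move=> [psi psi_iso]; have [e | ne] := eqVneq 1%g a; last first.
  by exists psi; split=> // x e; rewrite e eqxx in ne.
subst a; have [psi1 [psi1_iso psi1E]] := bccast_iso (cd_L1 U).
by exists psi1; split=> // x _; rewrite psi1E degmap_id.
Qed.

Theorem theorem2p8 (K : closedFieldType) (charK : [pchar K] =i pred0)
    (H : hopfAlg K) (Gamma : finGroupType) (U : crossedDatum H Gamma)
    (theta : identifications U) (c : braiding theta) :
  [/\ forall a : Gamma,
        exists psi : {lrmorphism cd_L U a -> regbc H}, bicomodAlg_iso psi,
      forall a b : Gamma, (a * b)%g = (b * a)%g
    & exists (g : Gamma -> Gamma -> grouplikes H)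
             (f : forall a b : Gamma, {lrmorphism twist (regbc H) (g a b) -> regbc H})
             (gamma : Gamma -> Gamma -> Gamma -> K),
        Hdatum f gamma /\ comes_from U f gamma].
Proof.
split; [exact: braided_iso c | exact: braided_abelian c |].
(* Classical choice turns the isomorphisms, and then their inverses, into families indexed by the
   group. *)
pose P a := boolp.cid (bicomodAlg_iso_cd_L1 (braided_iso c a)).
pose p a := sval (P a).
have p_iso a : bicomodAlg_iso (p a) by have [] := svalP (P a).
pose Q a := boolp.cid (bicomodAlg_iso_inv (p_iso a)).
have qP a := svalP (Q a).
apply: (@transport _ _ _ U p (fun a => sval (Q a))) => //.
- by move=> a; have [] := qP a.
- by move=> a; have [] := qP a.
- by move=> a; have [] := qP a.
- by move=> x; have [_ /(_ x erefl)] := svalP (P 1%g); rewrite degmap_id.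
- exact: braided_phi c.
Qed.
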